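(* (1) For every integer $m\ge 1$, we have $$\mathbb{R}^{\mathbb{N}}/c_0<_B\mathbb{R}^{\mathbb{N}}/\mathrm{cs}^{(m)}\le_B\mathbb{R}^{\mathbb{N}}/\mathrm{cs}^{(m+1)}<_B\mathbb{R}^{\mathbb{N}}/\mathrm{cs}^{(\infty)}.$$ (2) Let $(x_n)$ be a sequence of non-zero elements in $c_0$. Then $$\mathbb{R}^{\mathbb{N}}/c_0\le_B E(c_0,(x_n))\le_B\mathbb{R}^{\mathbb{N}}/\mathrm{cs}^{(\infty)}.$$
   Context: $\mathbb{N}=\{0,1,2,\dots\}$; $c_0$ is the Banach space of real null sequences with the sup norm. For a sequence $(x_n)$ in a Banach space $X$, $\mathrm{coef}(X,(x_n))=\{a\in\mathbb{R}^{\mathbb{N}}:\sum_n a(n)x_n\text{ converges in }X\}$, and $E(X,(x_n))$ is the equivalence relation on $\mathbb{R}^{\mathbb{N}}$ with $(a,b)\in E(X,(x_n))\iff a-b\in\mathrm{coef}(X,(x_n))$. For a linear subspace $L\subseteq\mathbb{R}^{\mathbb{N}}$, $\mathbb{R}^{\mathbb{N}}/L$ is the equivalence relation on $\mathbb{R}^{\mathbb{N}}$ in which $a,b$ are equivalent iff $a-b\in L$. For $m\ge1$, identify $c_0$ with $\bigoplus_{i=1}^m c_0$, let $(e^i_k)_{k\in\mathbb{N}}$ be the unit vector basis of the $i$-th component, set $x^m_{mj+i-1}=\sum_{k\le j}e^i_k$ for $1\le i\le m$ and $j\in\mathbb{N}$, and let $\mathrm{cs}^{(m)}=\mathrm{coef}(c_0,(x^m_n))$;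 explicitly, $\mathrm{cs}^{(m)}=\{a\in\mathbb{R}^{\mathbb{N}}:\sum_j a(mj+i-1)\text{ converges for each }1\le i\le m\}$. Identify $c_0$ with $\left(\bigoplus_{i\in\mathbb{N}}c_0\right)_0=\{(a_n)\in(c_0)^{\mathbb{N}}:\lim_n\|a_n\|=0\}$ (sup norm), let $(e^i_k)_{k\in\mathbb{N}}$ be the unit vector basis of the $i$-th component, and fix a bijection $\langle\cdot,\cdot\rangle:\mathbb{N}^2\to\mathbb{N}$ such that for each $i$, $\langle i,j\rangle$ is strictly increasing in $j$. Set $x^\infty_n=\sum_{k\le j}e^i_k$ for $n=\langle i,j\rangle$, and $\mathrm{cs}^{(\infty)}=\mathrm{coef}(c_0,(x^\infty_n))$. For equivalence relations $E,F$ on Polish spaces $Z,W$, $E\le_B F$ means there is a Borel function $\theta:Z\to W$ with $(x,y)\in E\iff(\theta(x),\theta(y))\in F$ for all $x,y\in Z$; $E<_B F$ means $E\le_B F$ and not $F\le_B E$. *)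

(* Defs.v *)
From HB Require Import structures.
From mathcomp Require Import all_boot all_order all_algebra.
From mathcomp Require Import all_classical all_reals all_analysis.

Set Implicit Arguments.
Unset Strict Implicit.
Unset Printing Implicit Defensive.
Import Order.TTheory GRing.Theory Num.Theory.
Import numFieldNormedType.Exports.
Local Open Scope classical_set_scope.
Local Open Scope ring_scope.

Section NullSequences.
Variable R : realType.

Definition null_seq : set (nat -> R) := [set a | a n @[n --> \oo] --> 0].

Definition null_seq_pred : {pred (nat -> R)} := mem null_seq.

Lemma null_seq_submod_closed : submod_closed null_seq_pred.
Proof.
split=> [|c a b]; rewrite !inE /null_seq /=; first exact: cvg_cst.
move=> a0 b0.
have ca0 : c * a n @[n --> \oo] --> c * 0 by apply: cvgM a0; exact: cvg_cst.
have : c * a n + b n @[n --> \oo] --> c * 0 + 0 by exact: cvgD.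
by rewrite mulr0 addr0.
Qed.

HB.instance Definition _ :=
  GRing.isSubmodClosed.Build R (nat -> R) null_seq_pred null_seq_submod_closed.

Record c0 := C0 { c0_val :> nat -> R; c0_valP : c0_val \in null_seq_pred }.

HB.instance Definition _ := [isSub for c0_val].
HB.instance Definition _ := [Choice of c0 by <:].
HB.instance Definition _ := [SubChoice_isSubLmodule of c0 by <:].

Definition c0_norm (x : c0) : R := sup (range (fun n => `|x n|)).

Lemma c0_cvg (x : c0) : x n @[n --> \oo] --> 0.
Proof. by have := c0_valP x; rewrite inE. Qed.

Lemma c0_has_sup (x : c0) : has_sup (range (fun n => `|x n|)).
Proof.
split; first by exists `|x 0%N|, 0%N.
have /cvg_seq_bounded[M [_ xM]] : cvgn (x : nat -> R).
  by apply/cvg_ex; exists 0; exact: c0_cvg.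
exists (M + 1) => _ [n _ <-]; apply: (xM (M + 1)) => //.
by rewrite ltrDl.
Qed.

Lemma c0_norm_ge (x : c0) n : `|x n| <= c0_norm x.
Proof. by apply: ub_le_sup; [case: (c0_has_sup x)|exists n]. Qed.

Lemma c0_norm_le (x : c0) M : (forall n, `|x n| <= M) -> c0_norm x <= M.
Proof.
by move=> xM; apply: ge_sup; [case: (c0_has_sup x)|move=> _ [n _ <-]].
Qed.

Lemma c0_ler_normD (x y : c0) : c0_norm (x + y) <= c0_norm x + c0_norm y.
Proof.
apply: c0_norm_le => n; apply: (le_trans (ler_normD _ _)).
by apply: lerD; exact: c0_norm_ge.
Qed.

Lemma c0_normZ (c : R) (x : c0) : c0_norm (c *: x) = `|c| * c0_norm x.
Proof.
have leZ (d : R) (y : c0) : c0_norm (d *: y) <= `|d| * c0_norm y.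
  apply: c0_norm_le => n; rewrite [leLHS](normrM d (y n)).
  by rewrite ler_wpM2l// c0_norm_ge.
apply/eqP; rewrite eq_le leZ /=.
have [->|c0] := eqVneq c 0.
  by rewrite normr0 mul0r (le_trans (normr_ge0 _) (c0_norm_ge _ 0)).
by rewrite -ler_pdivlMl ?normr_gt0// -normfV -{1}[x](scalerK c0) leZ.
Qed.

Lemma c0_norm_eq0 (x : c0) : c0_norm x = 0 -> x = 0.
Proof.
move=> x0; apply/val_inj/funext => n; apply/eqP.
by rewrite -normr_le0 -x0 c0_norm_ge.
Qed.

HB.instance Definition _ := @Lmodule_isNormed.Build R c0
  c0_norm c0_ler_normD c0_normZ c0_norm_eq0.

Lemma c0_complete (F : set_system c0) : ProperFilter F -> cauchy F -> cvg F.
Proof.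
move=> FF Fc.
have Fball (e : R) : 0 < e -> exists x : c0, F (ball x e).
  by move=> e0; have /cauchyP := Fc; exact.
have coord n : cvg ((fun x : c0 => x n) @ F).
  apply: cauchy_cvg; apply: cauchy_exP => e e0.
  have [x Fx] := Fball e e0; exists (x n).
  apply: (@filterS _ F _ (ball x e)) => // y.
  rewrite -!ball_normE /=; exact: le_lt_trans (c0_norm_ge (x - y) n).
pose l n := lim ((fun x : c0 => x n) @ F).
have lclose (e : R) (x : c0) : F (ball x e) -> forall n, `|x n - l n| <= e.
  move=> Fx n.
  have xl : `|x n - y n| @[y --> F] --> `|x n - l n|.
    by apply: cvg_norm; apply: cvgB; [exact: cvg_cst|exact: coord].
  apply: (cvgr_to_le xl); apply: (@filterS _ F _ (ball x e)) => // y.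
  rewrite -ball_normE /= => xy; exact: le_trans (c0_norm_ge (x - y) n) (ltW xy).
have l0 : l \in null_seq_pred.
  rewrite inE; apply/cvgr0Pnorm_le => e e0.
  have e20 : 0 < e / 2 by rewrite divr_gt0.
  have [x Fx] := Fball _ e20.
  have /cvgr0Pnorm_le/(_ _ e20) := c0_cvg x; apply: filterS => n xn.
  rewrite [e]splitr -[l n](subKr (x n)).
  by apply: (le_trans (ler_normB _ _)); rewrite lerD// lclose.
apply/cvg_ex; exists (C0 l0); apply/cvgrPdist_le => e e0.
have e20 : 0 < e / 2 by rewrite divr_gt0.
have [x Fx] := Fball _ e20.
apply: (@filterS _ F _ (ball x (e / 2))) => // y; rewrite -ball_normE /= => /ltW xy.
apply: c0_norm_le => n; rewrite [e]splitr.
have -> : (C0 l0 - y) n = (x - y) n - (x n - l n).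
  by rewrite opprB [RHS]addrC addrA subrK.
apply: (le_trans (ler_normB _ _)); rewrite lerD ?lclose//.
exact: le_trans (c0_norm_ge (x - y) n) xy.
Qed.

HB.instance Definition _ := Uniform_isComplete.Build c0 c0_complete.

Lemma unit_vector_subproof (k : nat) : (fun n => (n == k)%:R : R) \in null_seq_pred.
Proof.
rewrite inE; apply: cvg_near_cst; near=> n.
suff /gtn_eqF -> : (k < n)%N by [].
by near: n; exact: nbhs_infty_gt.
Unshelve. all: by end_near. Qed.

Definition unit_vector (k : nat) : c0 := C0 (unit_vector_subproof k).

End NullSequences.
Arguments null_seq : clear implicits.

Definition coef (R : realType) (X : completeNormedModType R) (x : nat -> X) :
    set (nat -> R) :=
  [set a | cvgn (series (fun n => a n *: x n))].

(* The carrier [{ptws nat -> R}] is [nat -> R] with the product topology. *)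
Definition quot_rel (R : realType) (L : set (nat -> R))
    (a b : {ptws nat -> R}) : Prop :=
  L (fun n => a n - b n).

Definition E_rel (R : realType) (X : completeNormedModType R) (x : nat -> X) :=
  quot_rel (coef x).

Definition borel_set (Z : topologicalType) : set (set Z) := <<s @open Z >>.

Definition borel_fun (Z W : topologicalType) (f : Z -> W) : Prop :=
  forall B, borel_set B -> borel_set (f @^-1` B).

Definition borel_le (Z W : topologicalType)
    (E : Z -> Z -> Prop) (F : W -> W -> Prop) : Prop :=
  exists2 f : Z -> W, borel_fun f & forall x y, E x y <-> F (f x) (f y).

Definition borel_lt (Z W : topologicalType)
    (E : Z -> Z -> Prop) (F : W -> W -> Prop) : Prop :=
  borel_le E F /\ ~ borel_le F E.

(* c_0 is identified with the sum of m copies of itself by interleaving: the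
   k-th unit vector of component r < m (counted from 0) is the unit vector
   number m * k + r of c_0. With n = m * j + r, 0 <= r < m, the index n below
   thus belongs to component r + 1 in the usual numbering from 1. *)
Definition x_fin (R : realType) (m n : nat) : c0 R :=
  \sum_(k < (n %/ m).+1) unit_vector R (m * k + n %% m)%N.

Definition cs_fin (R : realType) (m : nat) : set (nat -> R) :=
  coef (x_fin R m).
Arguments cs_fin : clear implicits.

Record pairing := Pairing {
  pair_code :> nat * nat -> nat;
  pair_decode : nat -> nat * nat;
  pair_codeK : cancel pair_code pair_decode;
  pair_decodeK : cancel pair_decode pair_code;
  pair_code_lt : forall i j k : nat,
    (j < k)%N -> (pair_code (i, j) < pair_code (i, k))%N
}.

(* The c_0-sum of countably many copies of c_0 is the space of null double
   sequences; it is identified with c_0 through the pairing p itself, so that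
   the k-th unit vector of component i is the unit vector number p (i, k). *)
Definition x_inf (R : realType) (p : pairing) (n : nat) : c0 R :=
  let: (i, j) := pair_decode p n in
  \sum_(k < j.+1) unit_vector R (p (i, val k)).

Definition cs_inf (R : realType) (p : pairing) : set (nat -> R) :=
  coef (x_inf R p).
Arguments cs_inf : clear implicits.

(* Main.v *)
Require Import Defs.
From HB Require Import structures.
From mathcomp Require Import all_boot all_order all_algebra.
From mathcomp Require Import all_classical all_reals all_analysis.
From mathcomp Require Import measurable_realfun.
From mathcomp Require Import zify ring lra.

(** Throughout, convergence of a series in [c0] is Cauchy's criterion uniformly in
    the coordinates ([coefP]). For the sequences defining [cs_fin] and [cs_inf]
    it becomes a condition on rows: all row series converge, with late blocks
    uniformly small ([coef_rows]).

    The reductions are linear and diagonal ([rescale]). Null sequences reduce to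
    any [E_rel x] by means of pairs of normalised vectors that nearly agree on all
    coordinates used so far: the differences of these pairs are almost disjoint
    blocks, so a series of them with coefficients [a k] converges iff [a k] tends
    to [0] ([null_le_coef]). [E_rel x] reduces to [cs_inf] by writing the series
    in coordinate [i] into row [i] ([coef_le_cs_inf]).

    For the non-reducibility results a Borel reduction is restricted to a Cantor
    set of points with digits of prescribed weights. Borel functions have the
    property of Baire, and finite changes of the digits do not change the class
    of a point; a fusion argument therefore selects a subset of the digits such
    that, over consecutive intervals [[K l, K l.+1]], the increments of the
    image sequences depend only on the [l]-th digit, up to summable errors
    ([stabilization]). After this the image of a selection of digits is
    equivalent to the image of the empty selection iff the increments of the
    selected digits tend to [0] uniformly and, in each target row, the series of
    their endpoint increments converges ([normal_form], [cauchy_increments],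
    [increments_cauchy]).

    If the target consists of null sequences, only the size of the increments
    matters. With weights from the alternating harmonic series, the selection of
    all digits is equivalent to the empty one, which forces the increments to
    tend to [0]; then every selection is equivalent to the empty one, in
    contradiction with the divergence of the harmonic series
    ([cs_fin_not_le_null]).

    If the source is [cs_inf] and the target [cs_fin m], finite dimension enters
    through the fact that unconditional convergence is absolute convergence.
    Selections with one digit per row, of weights [1 / (q + 1)] tending to [0],
    are equivalent to the empty one, and so are their sub-selections; hence the
    endpoint increments are absolutely small for almost all digits of almost all
    rows. Rows that are completely selected have sum [1], so selecting
    infinitely many of them is not equivalent to the empty selection, but the
    images converge absolutely when the rows are well chosen ([cs_inf_not_le_cs_fin]). *)

Set Implicit Arguments.
Unset Strict Implicit.
Unset Printing Implicit Defensive.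
Import Order.TTheory GRing.Theory Num.Theory.
Import numFieldNormedType.Exports.
Local Open Scope classical_set_scope.
Local Open Scope ring_scope.

(** * Baire category on the Cantor space *)

Definition bits := nat -> bool.
HB.instance Definition _ := Choice.on bits.
HB.instance Definition _ := Pointed.on bits.

Definition agree (N : nat) (x y : bits) := forall n, (n < N)%N -> x n = y n.

Lemma agree_refl N x : agree N x x. Proof. by []. Qed.

Lemma agree_trans N x y z : agree N x y -> agree N y z -> agree N x z.
Proof. by move=> xy yz n nN; rewrite xy ?yz. Qed.

Lemma agree_le M N x y : (M <= N)%N -> agree N x y -> agree M x y.
Proof. by move=> MN xy n nM; apply: xy; exact: leq_trans nM MN. Qed.

(** The cylinder determined by [x'] and [N'] lies in [D], so that [D] contains a
    dense open set. *)
Definition co_nowhere_dense (D : set bits) := forall x N, exists x' N',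
  agree N x x' /\ forall x'', agree N' x' x'' -> D x''.

Definition comeager (G : set bits) :=
  exists2 D : nat -> set bits, forall n, co_nowhere_dense (D n) &
    forall x, (forall n, D n x) -> G x.

Lemma co_nowhere_dense_comeager D : co_nowhere_dense D -> comeager D.
Proof. by move=> fD; exists (fun=> D) => // x; apply; exact: 0%N. Qed.

Lemma comeager_bigcap (G : nat -> set bits) :
  (forall n, comeager (G n)) -> comeager (\bigcap_n G n).
Proof.
move=> cG.
have /choice[D Dn] : forall n, exists D : nat -> set bits,
    (forall k, co_nowhere_dense (D k)) /\ forall x, (forall k, D k x) -> G n x.
  by move=> n; have [D] := cG n; exists D.
pose f k : nat * nat := odflt (0, 0)%N (unpickle k).
exists (fun k => D (f k).1 (f k).2); first by move=> k; case: (Dn (f k).1).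
move=> x Dx n _; apply: (Dn n).2 => k.
by have := Dx (pickle (n, k)); rewrite /f pickleK.
Qed.

Lemma comeagerI G H : comeager G -> comeager H -> comeager (G `&` H).
Proof.
move=> cG cH; rewrite -bigcap2E; apply: comeager_bigcap => -[|[|n]] //=.
by exists (fun=> setT) => // _ x N; exists x, N.
Qed.

(** Completeness of the Cantor space, in the form needed by the two
    constructions by successive approximation below. *)
Lemma fusion_limit (x : nat -> bits) (N : nat -> nat) :
    (forall l, (l <= N l)%N) -> (forall l, (N l <= N l.+1)%N) ->
    (forall l, agree (N l) (x l) (x l.+1)) ->
  exists y, forall l, agree (N l) (x l) y.
Proof.
move=> lN Nmono xx.
have xl l k : (l <= k)%N -> (N l <= N k)%N /\ agree (N l) (x l) (x k).
  elim: k => [|k IH]; first by rewrite leqn0 => /eqP ->.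
  rewrite leq_eqVlt => /orP[/eqP -> //|]; rewrite ltnS => /IH[h1 h2]; split.
    exact: leq_trans h1 (Nmono k).
  exact/(agree_trans h2)/(agree_le h1).
exists (fun n => x n.+1 n) => l n nN.
have [ln|nl] := leqP l n.+1; first exact: (xl _ _ ln).2.
by apply/esym/(xl _ _ (ltnW nl)).2; apply: leq_trans (lN _).
Qed.

(** Baire's theorem: inside any cylinder, shrink it successively into the sets
    [D 0], [D 1], ... and take the limit point. *)
Lemma comeager_dense G x N : comeager G -> exists2 y, agree N x y & G y.
Proof.
move=> [D fD DG].
have /choice[step stepP] : forall s : nat * (bits * nat), exists t : bits * nat,
    [/\ agree s.2.2 s.2.1 t.1, (s.2.2 < t.2)%N
      & forall z, agree t.2 t.1 z -> D s.1 z].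
  move=> [l [u M]] /=; have [u' [M' [uu' D']]] := fD l u M.
  exists (u', maxn M.+1 M'); split=> //=; first by rewrite leq_max leqnn.
  by move=> z zM; apply/D'/(agree_le _ zM); rewrite leq_max leqnn orbT.
pose st := fix st l := if l is l'.+1 then step (l', st l') else (x, N).
have stP l := stepP (l, st l).
have [| | |y yP] := @fusion_limit (fst \o st) (snd \o st).
- elim=> [|l IH] //=; have [_ + _] := stP l; exact: leq_ltn_trans.
- by move=> l; have [_ /ltnW] := stP l.
- by move=> l; have [] := stP l.
exists y; first exact: (yP 0%N).
by apply: DG => l; have [_ _] := stP l; apply; exact: (yP l.+1).
Qed.

Definition overwrite (s : seq bool) (x : bits) : bits :=
  fun n => if (n < size s)%N then nth false s n else x n.

Lemma agree_overwrite N s x y : agree N x y -> agree N (overwrite s x) (overwrite s y).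
Proof. by move=> xy n nN; rewrite /overwrite xy. Qed.

(** Overwriting an initial segment is an open map onto a cylinder, so it cannot
    pull a dense open set back to one that misses some cylinder. *)
Lemma comeager_overwrite G s : comeager G -> comeager [set x | G (overwrite s x)].
Proof.
move=> [D fD DG]; exists (fun n => [set x | D n (overwrite s x)]); last first.
  by move=> x Dx; exact: DG.
move=> k x N; have [x' [N' [xx' D']]] := fD k (overwrite s x) (maxn N (size s)).
exists (fun n => if (n < size s)%N then x n else x' n), (maxn N' (size s)); split.
  move=> n nN; case: ifPn => // ns; rewrite -xx' ?leq_max ?nN//.
  by rewrite /overwrite (negbTE ns).
move=> x'' xx''; apply: D' => n nN; rewrite /overwrite; case: ifPn => ns.
  by rewrite -xx' ?leq_max ?ns ?orbT// /overwrite ns.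
by rewrite -xx'' ?leq_max ?nN// (negbTE ns).
Qed.

(** A generic point stays generic under all finite changes, because there are
    only countably many of them. *)
Lemma comeager_all_overwrite G : comeager G ->
  comeager [set x | forall s, G (overwrite s x)].
Proof.
move=> cG; pose f k : seq bool := odflt [::] (unpickle k).
suff : comeager (\bigcap_k [set x | G (overwrite (f k) x)]).
  case=> D fD DG; exists D => // x /DG Gx s.
  by have := Gx (pickle s) I; rewrite /= /f pickleK.
by apply: comeager_bigcap => k; exact: comeager_overwrite.
Qed.

(** * Sets with the Baire property *)

(** [A] is relatively clopen in [G]: in the language of forcing, initial
    segments of the points of [G] decide membership in [A]. *)
Definition decided (G A : set bits) := forall x, G x -> exists N,
  forall x', G x' -> agree N x x' -> A x <-> A x'.

(** Equivalent to the usual definition (equality with an open set up to a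
    meager set), and symmetric under complement by construction. *)
Definition baire_property (A : set bits) := exists2 G, comeager G & decided G A.

Lemma decided_sub G H A : H `<=` G -> decided G A -> decided H A.
Proof.
move=> HG dA x /HG Gx; have [N NP] := dA _ Gx.
by exists N => x' /HG Gx'; exact: NP.
Qed.

Definition bits_open (U : set bits) :=
  forall x, U x -> exists N, forall x', agree N x x' -> U x'.

(** The boundary of an open set is nowhere dense. *)
Lemma bits_open_decided U : bits_open U ->
  co_nowhere_dense [set x | U x \/ exists N, forall x', agree N x x' -> ~ U x'].
Proof.
move=> oU x N; have [[x' xx' Ux']|nU] := pselect (exists2 x', agree N x x' & U x').
  by have [N' N'U] := oU _ Ux'; exists x', N'; split => // z /N'U; left.
exists x, N; split => // z xz; right; exists N => x' zx' Ux'; apply: nU.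
by exists x' => //; exact: agree_trans zx'.
Qed.

Lemma baire_property_open U : bits_open U -> baire_property U.
Proof.
move=> oU; eexists; first exact: co_nowhere_dense_comeager (bits_open_decided oU).
move=> x [Ux|[N NU]].
  by have [N NU] := oU _ Ux; exists N => x' _ /NU Ux'.
exists N => x' _ xx'; split=> h; first by case: (NU x (@agree_refl _ _)).
by case: (NU x').
Qed.

Lemma baire_property0 : baire_property set0.
Proof. by apply: baire_property_open => x []. Qed.

Lemma baire_propertyC A : baire_property A -> baire_property (~` A).
Proof.
move=> [G cG dA]; exists G => // x /dA[N NP]; exists N => x' Gx' xx'.
by have := NP _ Gx' xx'; rewrite /setC/=; tauto.
Qed.

(** On the intersection [H] of the comeager sets that decide the [A n], the union
    is relatively open, given by the open set [U]; removing the nowhere dense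
    boundary of [U] makes it relatively clopen. *)
Lemma baire_property_bigcup (A : nat -> set bits) :
  (forall n, baire_property (A n)) -> baire_property (\bigcup_n A n).
Proof.
move=> bA.
have /choice[G GP] : forall n, exists G, comeager G /\ decided G (A n).
  by move=> n; have [G] := bA n; exists G.
pose H := \bigcap_n G n.
pose U := [set x | exists n N, forall x', H x' -> agree N x x' -> A n x'].
have oU : bits_open U.
  move=> x [n [N NP]]; exists N => x' xx'; exists n, N => z Hz xz.
  by apply: NP => //; exact: agree_trans xz.
have HU x : H x -> U x <-> (\bigcup_n A n) x.
  move=> Hx; split=> [[n [N NP]]|[n _ Ax]].
    by exists n => //; exact: NP.
  have [N NP] := (GP n).2 x (Hx n I); exists n, N => x' Hx' xx'.
  by apply/(NP x') => //; exact: Hx'.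
exists (H `&` [set x | U x \/ exists N, forall x', agree N x x' -> ~ U x']).
  apply: comeagerI; first by apply: comeager_bigcap => n; exact: (GP n).1.
  exact: co_nowhere_dense_comeager (bits_open_decided oU).
move=> x [Hx [Ux|[N NU]]].
  have [N NU] := oU _ Ux; exists N => x' [Hx' _] xx'.
  by rewrite -!HU//; split => // _; exact: NU.
exists N => x' [Hx' _] xx'; rewrite -!HU//.
split=> h; first by case: (NU x (@agree_refl _ _)).
by case: (NU x').
Qed.

Definition bits_display : measure_display. Proof. by constructor. Qed.

(** Taking the sets with the Baire property as the measurable sets gives access
    to the arithmetic of measurable functions. *)
HB.instance Definition _ := @isMeasurable.Build bits_display bits
  baire_property baire_property0 baire_propertyC baire_property_bigcup.

(** This is what Borel functions are used through: finitely many of countably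
    many Borel conditions on a point of [G] depend only on an initial segment. *)
Lemma common_decided (J : countType) (A : J -> set bits) :
    (forall i, baire_property (A i)) ->
  exists2 G, comeager G & forall i, decided G (A i).
Proof.
move=> bA.
have /choice[G GP] : forall i, exists G, comeager G /\ decided G (A i).
  by move=> i; have [G] := bA i; exists G.
pose f k := if unpickle k is Some i then G i else setT.
exists (\bigcap_k f k).
  apply: comeager_bigcap => k; rewrite /f.
  case: unpickle => [i|]; first exact: (GP i).1.
  by apply: co_nowhere_dense_comeager => x N; exists x, N.
move=> i; apply: decided_sub (GP i).2 => x /(_ (pickle i) I).
by rewrite /f pickleK.
Qed.

(** * Stabilization *)

Lemma comeager_open G : comeager G -> exists D : nat -> set bits,
  [/\ forall n, co_nowhere_dense (D n), forall n, bits_open (D n)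
    & forall x, (forall n, D n x) -> G x].
Proof.
move=> [D fD DG].
exists (fun n => [set x | exists N, forall x', agree N x x' -> D n x']); split.
- move=> n x N; have [x' [N' [xx' D']]] := fD n x N.
  exists x', N'; split=> // z xz; exists N' => t zt; apply: D'.
  exact: agree_trans zt.
- move=> n x [N ND]; exists N => x' xx'; exists N => z xz; apply: ND.
  exact: agree_trans xz.
- by move=> x xD; apply: DG => n; have [N] := xD n; apply.
Qed.

Definition cauchy_seq (R : realType) (s : nat -> R) :=
  forall e, 0 < e -> exists N, forall k k', (N <= k)%N -> (N <= k')%N ->
    `|s k - s k'| <= e.

(** The digits of [z] written into [y] at the positions [pos], where [y] is
    meant to vanish. *)
Definition plant (y : bits) (pos : nat -> nat) (z : bits) : bits :=
  fun n => y n || `[< exists2 l, pos l = n & z l >].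

(** The hypotheses on [f] are what a Borel reduction gives: measurability of the
    [f j k], also after overwriting an initial segment, and the fact that doing so
    alters the sequence [k |-> f j k x] only by a convergent one. *)
Section Stabilization.
Variables (R : realType) (J : finType) (f : J -> nat -> bits -> R).
Hypothesis mf : forall j k s, measurable_fun setT (f j k \o overwrite s).
Hypothesis cf : forall j x s s', size s = size s' ->
  cauchy_seq (fun k => f j k (overwrite s x) - f j k (overwrite s' x)).

Let tau (l : nat) : R := 2^-1 ^+ l.

Let tau_gt0 l : 0 < tau l.
Proof. by rewrite exprn_gt0// invr_gt0. Qed.

Let increment j k k' x := f j k x - f j k' x.

Let tail_small (i : seq bool * seq bool * J * nat * nat) : set bits :=
  let: (s, s', j, K, l) := i in
  [set x | forall k k', (K <= k)%N -> (K <= k')%N ->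
    `|increment j k k' (overwrite s x) - increment j k k' (overwrite s' x)|
      <= tau l].

Let in_cell (i : seq bool * J * nat * nat * int) : set bits :=
  let: (s, j, k, l, c) := i in
  [set x | Num.floor (f j k (overwrite s x) / tau l) = c].

Let norm_le_measurable (g : bits -> R) e : measurable_fun setT g ->
  measurable [set x | `|g x| <= e].
Proof.
move=> mg; have := mg measurableT `[- e, e]%classic (measurable_itv _).
by rewrite setTI; congr measurable; apply/seteqP; split=> x;
  rewrite /= in_itv/= -ler_norml.
Qed.

Let tail_small_baire i : baire_property (tail_small i).
Proof.
case: i => [[[[s s'] j] K] l].
rewrite (_ : tail_small _ = \bigcap_k \bigcap_k' [set x |
    (K <= k)%N -> (K <= k')%N ->
    `|increment j k k' (overwrite s x) - increment j k k' (overwrite s' x)|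
      <= tau l]); last first.
  by apply/seteqP; split=> x h k; [move=> _ k' _; exact: h|move=> k'; exact: h].
apply: (@bigcapT_measurable _ bits) => k; apply: bigcapT_measurable => k'.
have [Kk|Kk] := leqP K k; last first.
  by rewrite [X in measurable X](_ : _ = setT)//; apply/seteqP; split.
have [Kk'|Kk'] := leqP K k'; last first.
  by rewrite [X in measurable X](_ : _ = setT)//; apply/seteqP; split.
rewrite [X in measurable X](_ : _ = [set x |
    `|increment j k k' (overwrite s x) - increment j k k' (overwrite s' x)|
      <= tau l]); last first.
  by apply/seteqP; split=> x /=; [apply|].
by apply: norm_le_measurable; apply: measurable_funB; apply: measurable_funB;
  exact: mf.
Qed.

Let in_cell_baire i : baire_property (in_cell i).
Proof.
case: i => [[[[s j] k] l] c].
have := mf j k s measurableT (measurable_itv `[c%:~R * tau l, (c + 1)%:~R * tau l[).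
rewrite setTI; congr baire_property; apply/seteqP; split => x; rewrite /= in_itv/=.
  by rewrite -ler_pdivlMr// -ltr_pdivrMr// => h; apply/floor_def.
move=> <-; rewrite -ler_pdivlMr// -ltr_pdivrMr//.
exact: floor_itv.
Qed.

(** Since [in_cell] is decided by initial segments, so is the value of each
    [f j k] up to [tau l]: this replaces continuity on a comeager set. *)
Let same_cell (l : nat) (a b : R) :
  Num.floor (a / tau l) = Num.floor (b / tau l) -> `|a - b| <= tau l.
Proof.
move=> ab; have /andP[a1 a2] := floor_itv (a / tau l).
have /andP[b1 b2] := floor_itv (b / tau l).
rewrite -ab in b1 b2; rewrite intrD in a2 b2.
suff : `|a / tau l - b / tau l| <= 1.
  by rewrite -mulrBl normrM normfV (gtr0_norm (tau_gt0 l)) ler_pdivrMr// mul1r.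
by rewrite ler_norml; lra.
Qed.

(** Labels let the positions be chosen with a prescribed type: a position of
    every label occurs beyond any bound. *)
Variable lab : nat -> nat.
Hypothesis lab_inf : forall l N, exists2 n, (N <= n)%N & lab n = l.

Section Step.
Variables (G : set bits) (D : nat -> set bits).
Hypothesis Dfat : forall n, co_nowhere_dense (D n).
Hypothesis Dopen : forall n, bits_open (D n).
Hypothesis DG : forall x, (forall n, D n x) -> G x.
Hypothesis Gtail : forall i, decided G (tail_small i).
Hypothesis Gcell : forall i, decided G (in_cell i).

Let near_agree (P : set bits) x : (exists N, forall x', agree N x x' -> P x') ->
  \forall N \near \oo, forall x', agree N x x' -> P x'.
Proof.
move=> [N NP]; exists N => // M /= NM x' xx'; apply: NP.
exact: agree_le xx'.
Qed.

(** One step of the construction. A position [n] of label [b] is reserved, and a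
    generic point [x] is chosen beyond it. For each of the finitely many ways
    to overwrite the digits up to [n], the changes of the sequences are
    convergent, hence nearly constant from some [K] on; then the values up to
    [K] are determined up to [tau l] by the digits up to some [N]. Genericity
    of [x] makes both facts persist for all points of [G] that agree with [x]
    up to [N]. *)
Let step x0 N0 K0 l b : exists n x N K,
  [/\ [/\ (N0 <= n)%N, lab n = b, agree N0 x0 x, x n = false & (n < N)%N],
    (K0 < K)%N,
    forall x', agree N x x' -> forall s : n.+1.-tuple bool, forall i,
      (i <= l)%N -> D i (overwrite s x'),
    forall x', G x' -> agree N x x' -> forall s s' : n.+1.-tuple bool,
      forall j k k', (K <= k)%N -> (K <= k')%N ->
      `|increment j k k' (overwrite s x') - increment j k k' (overwrite s' x')|
        <= tau l
    & forall x', G x' -> agree N x x' -> forall s : n.+1.-tuple bool,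
      forall j k, (k <= K)%N ->
      `|f j k (overwrite s x') - f j k (overwrite s x)| <= tau l].
Proof.
have [n N0n labn] := lab_inf b N0.
pose x1 : bits := fun i => if (i < N0)%N then x0 i else false.
have cD : comeager [set x | forall s, (\bigcap_i D i) (overwrite s x)].
  apply: comeager_all_overwrite; apply: comeager_bigcap => i.
  exact: co_nowhere_dense_comeager.
have [x xx1 Dx] := comeager_dense x1 n.+1 cD.
have Gx : G x.
  apply: DG => i; have := Dx [::] i I; rewrite (_ : overwrite _ _ = x)//.
have hK : \forall K \near \oo, forall (s s' : n.+1.-tuple bool) j,
    tail_small (val s, val s', j, K, l) x.
  apply: filter_forall => s; apply: filter_forall => s'.
  apply: filter_forall => j.
  have [|K KP] := @cf j x s s' _ _ (tau_gt0 l); first by rewrite !size_tuple.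
  exists K => // K' /= KK' k k' k1 k2.
  have := KP k k' (leq_trans KK' k1) (leq_trans KK' k2).
  by congr (`|_| <= _); rewrite /increment; ring.
have [K [K0K KP]] := filter_ex (filterI (nbhs_infty_gt K0) hK).
have hD : \forall N \near \oo, forall (s : n.+1.-tuple bool) (i : 'I_l.+1) x',
    agree N x x' -> D i (overwrite s x').
  apply: filter_forall => s; apply: filter_forall => i; apply: near_agree.
  have [N ND] := Dopen (Dx s i I); exists N => x' xx'; apply: ND.
  exact: agree_overwrite.
have hT : \forall N \near \oo, forall (s s' : n.+1.-tuple bool) j x',
    agree N x x' -> G x' -> tail_small (val s, val s', j, K, l) x'.
  apply: filter_forall => s; apply: filter_forall => s'.
  apply: filter_forall => j; apply: near_agree.
  have [N NT] := Gtail (val s, val s', j, K, l) Gx; exists N => x' xx' Gx'.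
  by rewrite -NT//; exact: KP.
have hC : \forall N \near \oo, forall (s : n.+1.-tuple bool) j (k : 'I_K.+1) x',
    agree N x x' -> G x' ->
    `|f j k (overwrite s x') - f j k (overwrite s x)| <= tau l.
  apply: filter_forall => s; apply: filter_forall => j.
  apply: filter_forall => k; apply: near_agree.
  pose c := Num.floor (f j k (overwrite s x) / tau l).
  have [N NT] := Gcell (val s, j, val k, l, c) Gx; exists N => x' xx' Gx'.
  by apply: same_cell; apply/(NT _ Gx' xx').
have [N [nN [ND [NT NC]]]] := filter_ex (filterI (nbhs_infty_gt n)
  (filterI hD (filterI hT hC))).
have xn i : (i <= n)%N -> x i = x1 i by move=> ni; rewrite -xx1.
exists n, x, N, K; split => //.
- split=> //; last by rewrite xn// /x1 ltnNge N0n.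
  by move=> i iN0; rewrite xn ?/x1 ?iN0// ltnW// (leq_trans iN0).
- by move=> x' xx' s i il; exact: (ND s (Ordinal (il : (i < l.+1)%N))).
- by move=> x' Gx' xx' s s' j; exact: (NT s s' j x' xx' Gx').
- by move=> x' Gx' xx' s j k kK; exact: (NC s j (Ordinal (kK : (k < K.+1)%N))).
Qed.

(** The limit of the steps: changing digits before [pos l] hardly affects the
    increments beyond [K l], and digits after [pos l] hardly affect the values
    up to [K l.+1]; so the increments on [[K l, K l.+1]] depend only on the
    digit [z l]. *)
Lemma fusion : exists (y : bits) (pos K : nat -> nat),
  [/\ forall l, (pos l < pos l.+1)%N, forall l, lab (pos l) = l,
      forall l, y (pos l) = false, forall l, (K l < K l.+1)%N
    & forall l z z' j k k', z l = z' l ->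
      (K l <= k <= K l.+1)%N -> (K l <= k' <= K l.+1)%N ->
      `|increment j k k' (plant y pos z) - increment j k k' (plant y pos z')|
        <= 3 * tau l].
Proof.
(* A state is [(n, x, N, K)]; the step of index [0] only provides a start, so
   that the digit [z l] sits at the position chosen in step [l.+1]. *)
pose state := (nat * bits * nat * nat)%type.
have /choice[next nextP] : forall ls : nat * state, exists t : state,
    let: (l, (_, x0, N0, K0)) := ls in let: (n, x, N, K) := t in
  [/\ [/\ (N0 <= n)%N, lab n = l.-1, agree N0 x0 x, x n = false & (n < N)%N],
    (K0 < K)%N,
    forall x', agree N x x' -> forall s : n.+1.-tuple bool, forall i,
      (i <= l)%N -> D i (overwrite s x'),
    forall x', G x' -> agree N x x' -> forall s s' : n.+1.-tuple bool,
      forall j k k', (K <= k)%N -> (K <= k')%N ->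
      `|increment j k k' (overwrite s x') - increment j k k' (overwrite s' x')|
        <= tau l
    & forall x', G x' -> agree N x x' -> forall s : n.+1.-tuple bool,
      forall j k, (k <= K)%N ->
      `|f j k (overwrite s x') - f j k (overwrite s x)| <= tau l].
  move=> [l [[[n0 x0] N0] K0]]; have [n [x [N [K h]]]] := step x0 N0 K0 l l.-1.
  by exists (n, x, N, K).
pose st := fix st l : state :=
  next (l, if l is l'.+1 then st l' else (0, fun=> false, 0, 0)%N).
pose prev l := if l is l'.+1 then st l' else (0, fun=> false, 0, 0)%N : state.
have stE l : st l = next (l, prev l) by case: l.
pose nu l := (st l).1.1.1; pose x l := (st l).1.1.2.
pose N l := (st l).1.2; pose K l := (st l).2.
have stP l : [/\ (nu l < N l)%N, (lab (nu l) = l.-1) /\ (x l (nu l) = false),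
    (N l <= nu l.+1)%N, agree (N l) (x l) (x l.+1) & (K l < K l.+1)%N].
  rewrite /nu /x /N /K.
  have := nextP (l.+1, prev l.+1); have := nextP (l, prev l).
  rewrite -!stE -[prev l.+1]/(st l).
  case: (st l) => [[[n1 x1] N1] K1]; case: (st l.+1) => [[[n2 x2] N2] K2].
  by case: (prev l) => [[[? ?] ?] ?] /= [[? ? ? ? ?] ? ? ? ?] [[]].
have stD l x' (s : seq bool) i : agree (N l) (x l) x' -> size s = (nu l).+1 ->
    (i <= l)%N -> D i (overwrite s x').
  rewrite /nu /x /N; have := nextP (l, prev l).
  rewrite -stE; case: (st l) => [[[n1 x1] N1] K1].
  case: (prev l) => [[[? ?] ?] ?] [_ _ h _ _] xx' /eqP ss.
  exact: (h x' xx' (Tuple ss)).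
have stT l x' (s s' : seq bool) j k k' : G x' -> agree (N l) (x l) x' ->
    size s = (nu l).+1 -> size s' = (nu l).+1 -> (K l <= k)%N -> (K l <= k')%N ->
    `|increment j k k' (overwrite s x') - increment j k k' (overwrite s' x')|
        <= tau l.
  rewrite /nu /x /N /K; have := nextP (l, prev l).
  rewrite -stE; case: (st l) => [[[n1 x1] N1] K1].
  case: (prev l) => [[[? ?] ?] ?] [_ _ _ h _] Gx' xx'.
  move=> /eqP ss /eqP ss'; exact: (h x' Gx' xx' (Tuple ss) (Tuple ss')).
have stC l x' (s : seq bool) j k : G x' -> agree (N l) (x l) x' ->
    size s = (nu l).+1 -> (k <= K l)%N ->
    `|f j k (overwrite s x') - f j k (overwrite s (x l))| <= tau l.
  rewrite /nu /x /N /K; have := nextP (l, prev l).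
  rewrite -stE; case: (st l) => [[[n1 x1] N1] K1].
  case: (prev l) => [[[? ?] ?] ?] [_ _ _ _ h] Gx' xx'.
  move=> /eqP ss; exact: (h x' Gx' xx' (Tuple ss)).
have nu_lt l : (nu l < nu l.+1)%N.
  by have [h _ h' _ _] := stP l; exact: leq_trans h'.
have nu_mono l l' : (l < l')%N -> (N l <= nu l')%N.
  elim: l' => // l' IH; rewrite ltnS leq_eqVlt => /orP[/eqP ->|/IH h].
    by have [] := stP l'.
  exact: leq_trans h (ltnW (nu_lt l')).
have [| | |y yP] := @fusion_limit x N.
- elim=> // l IH; have [_ _ h _ _] := stP l; have [h' _ _ _ _] := stP l.+1.
  exact: leq_ltn_trans (leq_trans IH h) h'.
- move=> l; have [_ _ h _ _] := stP l; have [h' _ _ _ _] := stP l.+1.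
  exact: leq_trans h (ltnW h').
- by move=> l; have [] := stP l.
pose pos l := nu l.+1; pose P := plant y pos.
(* The digits of index less than [l] have been erased: this is the base point
   to which the estimates of step [l] apply. *)
pose erase l (z : bits) : bits := fun i => (l <= i)%N && z i.
have pos_le l i : (pos i <= nu l)%N = (i < l)%N.
  apply/idP/idP => [|il]; last first.
    have := nu_mono i.+1 l; rewrite /pos leq_eqVlt in il *.
    case/orP: il => [/eqP <- //|il h]; have [+ _ _ _ _] := stP i.+1.
    by move=> /ltnW/leq_trans; apply; exact: h.
  apply: contraTT; rewrite -!leqNgt -ltnNge => li.
  by have [+ _ _ _ _] := stP l; move/leq_trans; apply; exact: nu_mono.
have base l z : agree (N l) (x l) (P (erase l z)).
  apply: (agree_trans (yP l)) => n nN; rewrite /P /plant.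
  case: asboolP; rewrite ?orbF// => -[i posi /andP[li _]].
  by have := nu_mono l i.+1 li; rewrite leqNgt -/(pos i) posi nN.
have split_at l z : P z = overwrite (mkseq (P z) (nu l).+1) (P (erase l z)).
  apply/funext => n; rewrite /overwrite size_mkseq ltnS; case: leqP => nl.
    by rewrite nth_mkseq.
  rewrite /P /plant; congr orb; apply: asbool_equiv_eq; split=> -[i posi zi].
    by exists i => //; rewrite /erase zi andbT leqNgt -pos_le posi -ltnNge.
  by exists i => //; case/andP: zi.
have GP z : G (P z).
  apply: DG => i; rewrite (split_at i); apply: (stD i) => //.
  by rewrite size_mkseq.
exists y, pos, K; split.
- by move=> l; exact: nu_lt.
- by move=> l; have [_ [] ] := stP l.+1.
- by move=> l; have [h [_ <-] _ _ _] := stP l.+1; rewrite -(yP l.+1).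
- by move=> l; have [] := stP l.
move=> l z z' j k k' zz' /andP[k1 k2] /andP[k1' k2'].
(* [v] is halfway between the two points: the early digits come from [z'], the
   late ones from [z]. *)
pose v := overwrite (mkseq (P z') (nu l).+1) (P (erase l z)).
have vE : v = overwrite (mkseq (P z') (nu l.+1).+1) (P (erase l.+1 z)).
  apply/funext => n; rewrite /v /overwrite !size_mkseq !ltnS.
  have [nl|nl] := leqP n (nu l).
    by rewrite (leq_trans nl (ltnW (nu_lt l))) !nth_mkseq// ltnS// ltnW//
      (leq_ltn_trans nl).
  have [nl1|nl1] := leqP n (nu l.+1); rewrite ?nth_mkseq// /P /plant; congr orb.
    have il i : pos i = n -> i = l.
      move=> posi; have := pos_le l i; have := pos_le l.+1 i.
      by rewrite posi nl1 (leqNgt n) nl /=; lia.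
    apply: asbool_equiv_eq; split=> -[i /[dup]/il -> posi].
      by move=> /andP[_]; exists l; rewrite // -zz'.
    by move=> zi; exists l => //; rewrite /erase leqnn zz'.
  apply: asbool_equiv_eq; split=> -[i posi /andP[li zi]]; exists i => //.
    by rewrite /erase zi andbT ltnNge -ltnS -pos_le posi -ltnNge.
  by rewrite /erase zi andbT ltnW.
have h1 : `|increment j k k' (P z) - increment j k k' v| <= tau l.
  by rewrite {1}(split_at l z); apply: stT; rewrite ?size_mkseq.
have h2 i : (i <= K l.+1)%N -> `|f j i v - f j i (P z')| <= 2 * tau l.+1.
  move=> iK; rewrite vE {2}(split_at l.+1 z').
  set s := mkseq _ _.
  have ss : size s = (nu l.+1).+1 by rewrite size_mkseq.
  have := stC l.+1 _ _ j i (GP (erase l.+1 z)) (base l.+1 z) ss iK.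
  have := stC l.+1 _ _ j i (GP (erase l.+1 z')) (base l.+1 z') ss iK.
  by rewrite !ler_norml; lra.
have tauS : tau l = 2 * tau l.+1 by rewrite /tau exprS mulrA divff ?mul1r.
move: h1 (h2 _ k2) (h2 _ k2'); rewrite tauS !ler_norml /increment.
by rewrite -/P; lra.
Qed.

End Step.

(** Additive form of the fusion: on the [l]-th interval, planting [z] changes the
    increments of [f] by [h l] if [z l] holds and by nothing otherwise. *)
Lemma stabilization : exists (y : bits) (pos K : nat -> nat) (h : J -> nat -> nat -> R),
  [/\ forall l, (pos l < pos l.+1)%N, forall l, lab (pos l) = l,
      forall l, y (pos l) = false, forall l, (K l < K l.+1)%N
    & forall j l z k, (K l <= k <= K l.+1)%N ->
      `|(f j k (plant y pos z) - f j k y)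
        - (f j (K l) (plant y pos z) - f j (K l) y) - (z l)%:R * h j l k|
        <= 3 * tau l].
Proof.
have [G1 cG1 d1] := common_decided tail_small_baire.
have [G2 cG2 d2] := common_decided in_cell_baire.
have [D [Df Do DG]] := comeager_open (comeagerI cG1 cG2).
have [i|i|y [pos [K [h1 h2 h3 h4 h5]]]] := @fusion _ D Df Do DG.
- by apply: decided_sub (d1 i) => x [].
- by apply: decided_sub (d2 i) => x [].
have plant0 : plant y pos (fun=> false) = y.
  by apply/funext => n; rewrite /plant; case: asboolP; rewrite ?orbF// => -[].
exists y, pos, K, (fun j l k => increment j k (K l) (plant y pos (pred1 l))
  - increment j k (K l) y); split => // j l z k kK.
have lK : (K l <= K l <= K l.+1)%N by rewrite leqnn ltnW.
case zl: (z l); rewrite ?mul1r ?mul0r.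
  have := h5 l z (pred1 l) j _ _ _ kK lK; rewrite /= eqxx zl => /(_ erefl).
  by congr (`|_| <= _); rewrite /increment; ring.
have := h5 l z (fun=> false) j _ _ zl kK lK; rewrite plant0.
by congr (`|_| <= _); rewrite /increment; ring.
Qed.

End Stabilization.

Lemma half_pow_small (R : realType) (e : R) : 0 < e ->
  exists N, forall n, (N <= n)%N -> 2^-1 ^+ n <= e.
Proof.
move=> e0; have : (2^-1 : R) ^+ n @[n --> \oo] --> 0.
  by apply: cvg_expr; rewrite ger0_norm ?invr_ge0// invf_lt1// ltr1n.
move=> /cvgr0Pnorm_le/(_ e e0)[N _ NP]; exists N => n /NP.
by apply: le_trans; exact: ler_norm.
Qed.

Lemma sum_half_pow (R : realType) p q :
  \sum_(p <= l < q) (2^-1 : R) ^+ l <= 2 * 2^-1 ^+ p.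
Proof.
have [qp|/ltnW pq] := leqP q p.
  by rewrite big_geq// mulr_ge0// exprn_ge0// invr_ge0.
suff -> : \sum_(p <= l < q) (2^-1 : R) ^+ l = 2 * 2^-1 ^+ p - 2 * 2^-1 ^+ q.
  by rewrite lerBlDr lerDl mulr_ge0// exprn_ge0// invr_ge0.
elim: q pq => [|q IH]; first by rewrite leqn0 => /eqP ->; rewrite big_geq// subrr.
rewrite leq_eqVlt => /orP[/eqP <-|]; first by rewrite big_geq// subrr.
by rewrite ltnS => pq; rewrite big_nat_recr//= IH// exprS; field.
Qed.

Definition cauchy_series (R : realType) (u : nat -> R) :=
  forall e, 0 < e -> exists N, forall p q, (N <= p)%N ->
    `|\sum_(p <= l < q) u l| <= e.

(** A sequence whose increments over the intervals [[K l, K l.+1]] are known up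
    to a summable error converges iff these increments tend to [0] uniformly and
    the series of those between endpoints converges. *)
Section Increments.
Variables (R : realType) (s : nat -> R) (K : nat -> nat) (h : nat -> nat -> R).
Hypothesis K_lt : forall l, (K l < K l.+1)%N.
Hypothesis sh : forall l k, (K l <= k <= K l.+1)%N ->
  `|s k - s (K l) - h l k| <= 3 * 2^-1 ^+ l.

Let K_ge l : (l <= K l)%N.
Proof. by elim: l => // l IH; exact: leq_ltn_trans (K_lt l). Qed.

Lemma interval_of N k : (K N <= k)%N ->
  exists l, (N <= l)%N /\ (K l <= k < K l.+1)%N.
Proof.
move=> Nk; have kK : exists l, (k < K l.+1)%N by exists k; exact: leq_trans (K_ge k.+1).
have := ex_minnP kK; case=> l lk lmin; exists l.
have Kmono a b : (a <= b)%N -> (K a <= K b)%N.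
  elim: b => [|b IH]; first by rewrite leqn0 => /eqP ->.
  rewrite leq_eqVlt => /orP[/eqP -> //|]; rewrite ltnS => /IH h'.
  exact: leq_trans h' (ltnW (K_lt b)).
split.
  rewrite leqNgt; apply/negP => lN.
  by have := Kmono _ _ lN; rewrite leqNgt (leq_ltn_trans Nk lk).
rewrite lk andbT leqNgt; apply/negP => kl.
case: l lk lmin kl => [|l] lk lmin kl.
  by have := Kmono 0%N N isT; rewrite leqNgt (leq_ltn_trans Nk kl).
by have := lmin l kl; rewrite ltnn.
Qed.

(** The errors up to [q] add up to at most twice the first one. *)
Let endpoint_error p q : (p <= q)%N ->
  `|s (K q) - s (K p) - \sum_(p <= l < q) h l (K l.+1)| <= 6 * 2^-1 ^+ p.
Proof.
move=> pq; rewrite -(telescope_sumr (s \o K))// -sumrB.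
apply: le_trans (ler_norm_sum _ _ _) _.
apply: (@le_trans _ _ (3 * \sum_(p <= l < q) 2^-1 ^+ l)).
  rewrite mulr_sumr; apply: ler_sum => l _; apply: sh.
  by rewrite leqnn ltnW.
by have := sum_half_pow R p q; lra.
Qed.

Lemma cauchy_increments : cauchy_seq s ->
  (forall e, 0 < e -> exists N, forall l k, (N <= l)%N ->
     (K l <= k <= K l.+1)%N -> `|h l k| <= e) /\
  cauchy_series (fun l => h l (K l.+1)).
Proof.
move=> cs; split=> e e0.
  have [N NP] := cs (e / 2) ltac:(lra).
  have [M MP] := @half_pow_small R (e / 6) ltac:(lra).
  exists (maxn N M) => l k; rewrite geq_max => /andP[Nl Ml] kl.
  have := sh kl; have := NP (K l) k; case/andP: (kl) => lk _.
  move=> /(_ (leq_trans Nl (K_ge l))) /(_ (leq_trans Nl (leq_trans (K_ge l) lk))).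
  by have := MP l Ml; rewrite !ler_norml; lra.
have [N NP] := cs (e / 2) ltac:(lra).
have [M MP] := @half_pow_small R (e / 12) ltac:(lra).
exists (maxn N M) => p q; rewrite geq_max => /andP[Np Mp].
have [qp|/ltnW pq] := leqP q p; first by rewrite big_geq// normr0 ltW.
have := endpoint_error pq; have := NP (K p) (K q) (leq_trans Np (K_ge p))
  (leq_trans Np (leq_trans pq (K_ge q))).
by have := MP p Mp; rewrite !ler_norml; lra.
Qed.

Lemma increments_cauchy :
  (forall e, 0 < e -> exists N, forall l k, (N <= l)%N ->
     (K l <= k <= K l.+1)%N -> `|h l k| <= e) ->
  cauchy_series (fun l => h l (K l.+1)) -> cauchy_seq s.
Proof.
move=> osc cser e e0.
have [N1 NP1] := osc (e / 8) ltac:(lra).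
have [N2 NP2] := cser (e / 8) ltac:(lra).
have [N3 NP3] := @half_pow_small R (e / 48) ltac:(lra).
pose N := maxn N1 (maxn N2 N3).
have near_base k : (K N <= k)%N -> `|s k - s (K N)| <= e / 2.
  move=> Nk; have [l [Nl lk]] := interval_of Nk.
  have kl : (K l <= k <= K l.+1)%N by case/andP: lk => -> /ltnW.
  have := sh kl; have := endpoint_error Nl.
  have := NP1 l k; rewrite (leq_trans _ Nl) ?leq_max ?leqnn// => /(_ isT kl).
  have := NP2 N l; rewrite !leq_max leqnn !orbT => /(_ isT).
  have := NP3 N; rewrite !leq_max leqnn !orbT => /(_ isT).
  have := NP3 l; rewrite (leq_trans _ Nl) ?leq_max ?leqnn ?orbT// => /(_ isT).
  by rewrite !ler_norml; lra.
exists (K N) => k k' /near_base + /near_base.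
by rewrite !ler_norml; lra.
Qed.

End Increments.

(** * Convergence criteria for the coefficient spaces *)

Lemma null_seqP (R : realType) (a : nat -> R) : null_seq R a <->
  forall e, 0 < e -> exists N, forall n, (N <= n)%N -> `|a n| <= e.
Proof.
split=> [/cvgr0Pnorm_le aP e e0|aP].
  by have [N _ NP] := aP _ e0; exists N => n /NP.
by apply/cvgr0Pnorm_le => e /aP[N NP]; exists N.
Qed.

Lemma c0_sumE (R : realType) (I : Type) (r : seq I) (P : pred I) (F : I -> c0 R) i :
  (\sum_(j <- r | P j) F j) i = \sum_(j <- r | P j) F j i.
Proof. exact: (big_morph (fun x : c0 R => x i)). Qed.

(** The norm of [c0] being a supremum, this is Cauchy's criterion uniformly in
    the coordinate [i]. *)
Lemma coefP (R : realType) (x : nat -> c0 R) a : coef x a <->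
  forall e, 0 < e -> exists N, forall p q i, (N <= p)%N ->
    `|\sum_(p <= n < q) a n * x n i| <= e.
Proof.
have sumE p q i : (\sum_(p <= n < q) a n *: x n) i = \sum_(p <= n < q) a n * x n i.
  by rewrite c0_sumE.
rewrite /coef/=; split=> [/cauchy_cvgP/cauchy_seriesP xa e e0|xa].
  have [[A B] /= [[N1 _ A1] [N2 _ B2]] AB] := xa _ e0.
  exists (maxn N1 N2) => p q i; rewrite geq_max => /andP[N1p N2p].
  have [qp|/ltnW pq] := leqP q p; first by rewrite big_geq// normr0 ltW.
  have := AB (p, q); rewrite -sumE => /(_ _)/ltW; move=> /(_ _)h.
  apply: le_trans (c0_norm_ge _ _) (h _); split; first exact: A1.
  by apply: B2; exact: leq_trans pq.
apply/cauchy_cvgP/cauchy_seriesP => e e0.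
have [N NP] := xa (e / 2) ltac:(lra).
exists ([set n | (N <= n)%N], setT).
  by split; [exists N|exact: filterT].
move=> [p q] /= [Np _]; apply: (@le_lt_trans _ _ (e / 2)); last by lra.
by apply: c0_norm_le => i; rewrite sumE; exact: NP.
Qed.

Section Enumeration.
Variables (e : nat -> nat) (P : pred nat).
Hypothesis e_lt : forall j, (e j < e j.+1)%N.
Hypothesis Pe : forall n, P n <-> exists j, n = e j.

Lemma enum_ge j : (j <= e j)%N.
Proof. by elim: j => // j IH; exact: leq_ltn_trans (e_lt j). Qed.

Lemma enum_ltn i j : (e i < e j)%N = (i < j)%N.
Proof.
have lt_e : {homo e : i j / (i < j)%N}.
  by apply: homo_ltn => //; exact: ltn_trans.
by apply/idP/idP; [|exact: lt_e]; apply: contraTT; rewrite -!leqNgt leq_eqVlt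
  => /orP[/eqP -> //|/lt_e/ltnW].
Qed.

Lemma enum_inj : injective e.
Proof.
move=> i j eij; have := enum_ltn i j; have := enum_ltn j i.
by rewrite eij ltnn; case: ltngtP.
Qed.

(** The number of [j] with [e j < n]; a left inverse of [e] that also turns
    arbitrary bounds into bounds for indices, see [enum_countP]. *)
Definition enum_count n := ex_minn (ex_intro (fun j => n <= e j)%N n (enum_ge n)).

Lemma enum_countP n j : (j < enum_count n)%N = (e j < n)%N.
Proof.
rewrite /enum_count; case: ex_minnP => c nc cmin.
apply/idP/idP; first by rewrite !ltnNge; apply: contra => /cmin.
by move=> ejn; rewrite -enum_ltn; exact: leq_trans nc.
Qed.

Lemma enum_count_leq n j : (enum_count n <= j)%N = (n <= e j)%N.
Proof. by apply: negb_inj; rewrite -!ltnNge enum_countP. Qed.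

Lemma enum_count_enum j : enum_count (e j) = j.
Proof.
apply/eqP; rewrite eqn_leq enum_count_leq leqnn /=.
by case: j => // j; rewrite enum_countP.
Qed.

Lemma enum_count_homo m n : (m <= n)%N -> (enum_count m <= enum_count n)%N.
Proof. by move=> mn; rewrite enum_count_leq (leq_trans mn)// -enum_count_leq. Qed.

Lemma sum_enum (V : nmodType) (F : nat -> V) p q :
  \sum_(p <= n < q | P n) F n = \sum_(enum_count p <= j < enum_count q) F (e j).
Proof.
have mono := enum_count_homo.
have [qp|/ltnW pq] := leqP q p; first by rewrite !big_geq ?mono.
elim: q pq => [|q IH]; first by rewrite leqn0 => /eqP ->; rewrite !big_geq.
rewrite leq_eqVlt => /orP[/eqP <-|]; first by rewrite !big_geq.
rewrite ltnS => pq; rewrite [in LHS]big_mkcond big_nat_recr//= -big_mkcond IH//.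
case: ifPn => [/Pe[j qj]|nPq]; last first.
  rewrite addr0; congr (\sum_(_ <= _ < _) _); apply/eqP.
  rewrite eqn_leq mono//= enum_count_leq ltn_neqAle -enum_count_leq leqnn andbT.
  by apply: contra nPq => /eqP ->; apply/Pe; exists (enum_count q).
have cq : enum_count q = j by rewrite qj enum_count_enum.
have -> : enum_count q.+1 = j.+1.
  apply/eqP; rewrite eqn_leq enum_count_leq qj enum_ltn ltnS leqnn /=.
  by rewrite enum_countP.
have cpj : (enum_count p <= j)%N by rewrite -cq mono.
by rewrite [RHS]big_nat_recr//= -qj cq.
Qed.

End Enumeration.

(** The index set is cut into rows, [e i] being the increasing enumeration of row
    [i]. All row series converge, with late blocks uniformly small: a block is
    late when its first index [e i p] is, so rows that begin late must be small
    altogether. *)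
Definition row_cauchy (R : realType) (I : pred nat) (e : nat -> nat -> nat)
    (a : nat -> R) :=
  forall eps, 0 < eps -> exists N, forall i p q, I i -> (N <= e i p)%N ->
    `|\sum_(p <= j < q) a (e i j)| <= eps.

Section Rows.
Variables (R : realType) (row : nat -> nat) (I : pred nat) (e : nat -> nat -> nat).
Hypothesis e_lt : forall i j, I i -> (e i j < e i j.+1)%N.
Hypothesis row_e : forall i j, I i -> row (e i j) = i.
Hypothesis e_surj : forall n, I (row n) /\ exists j, n = e (row n) j.

Let rowP i : I i -> forall n, row n == i <-> exists j, n = e i j.
Proof.
move=> Ii n; split=> [/eqP <-|[j ->]]; first by have [] := e_surj n.
by rewrite row_e.
Qed.

(** Coordinate [i] of a partial sum collects the coefficients in the row of [i]
    from index [i] on; as [i] varies, all blocks of that row occur. *)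
Lemma coef_rows (x : nat -> c0 R) a :
    (forall n i, x n i = ((row i == row n) && (i <= n)%N)%:R) ->
  coef x a <-> row_cauchy I e a.
Proof.
move=> xE.
have sumE p q i : \sum_(p <= n < q) a n * x n i =
    \sum_(maxn p i <= n < q | row n == row i) a n.
  under eq_bigr do rewrite xE eq_sym.
  have [qp|/ltnW pq] := leqP q p.
    by rewrite !big_geq// (leq_trans qp)// leq_maxl.
  have [qi|/ltnW iq] := leqP q i.
    rewrite [RHS]big_geq ?(leq_trans qi) ?leq_maxr//.
    rewrite big_nat_cond big1// => n /andP[/andP[_ nq] _].
    by rewrite [(i <= n)%N]leqNgt (leq_trans nq)// andbF mulr0.
  rewrite (@big_cat_nat _ _ _ (maxn p i))/= ?leq_maxl ?geq_max ?pq//.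
  rewrite big_nat_cond big1 ?add0r; last first.
    move=> n /andP[/andP[pn]]; rewrite leq_max ltnNge pn/= => ni _.
    by rewrite leqNgt ni andbF mulr0.
  rewrite [RHS]big_mkcond/= !big_nat; apply: eq_bigr => n /andP[].
  rewrite geq_max => /andP[_ ->] _; rewrite andbT.
  by case: eqP; rewrite ?mulr1 ?mulr0.
rewrite coefP; split=> aP eps eps0; have [N NP] := aP _ eps0; exists N.
  move=> i p q Ii Np; have [qp|/ltnW pq] := leqP q p.
    by rewrite big_geq// normr0 ltW.
  have := NP (e i p) (e i q) (e i p) Np.
  have ei j := e_lt j Ii.
  by rewrite sumE maxnn row_e// (sum_enum ei (rowP Ii)) !enum_count_enum.
move=> p q i Np; rewrite sumE; have [Ii _] := e_surj i.
have ei j := e_lt j Ii.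
rewrite (sum_enum ei (rowP Ii)); apply: NP => //.
rewrite -(enum_count_leq ei) (leq_trans _ (leqnn _))//.
by rewrite enum_count_leq (leq_trans (leq_trans Np (leq_maxl p i)))// -(enum_count_leq ei).
Qed.

End Rows.

Lemma sum_indicator (R : realType) (e : nat -> nat) j i :
    (forall j, (e j < e j.+1)%N) ->
  \sum_(k < j.+1) (i == e k)%:R = ((i <= e j)%N && `[< exists k, i = e k >])%:R :> R.
Proof.
move=> e_lt; case: asboolP => [[k ->]|ni]; last first.
  by rewrite andbF big1// => k _; case: eqP => // ik; case: ni; exists k.
rewrite andbT; have [ejk|kj] := ltnP (e j) (e k).
  rewrite big1// => l _; case: eqP => // /(enum_inj e_lt) kl.
  by move: ejk; rewrite kl enum_ltn// ltnNge -ltnS ltn_ord.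
have kj1 : (k < j.+1)%N by rewrite ltnS leqNgt -(enum_ltn e_lt) -leqNgt.
rewrite (bigD1 (Ordinal kj1))//= eqxx big1 ?addr0// => l lk.
by case: eqP => // /(enum_inj e_lt) kl; rewrite -val_eqE /= kl eqxx in lk.
Qed.

Lemma cs_finP (R : realType) m a : (0 < m)%N ->
  cs_fin R m a <-> row_cauchy (fun i => i < m)%N (fun i j => m * j + i)%N a.
Proof.
move=> m0; have ei i j : (m * j + i < m * j.+1 + i)%N by lia.
apply: (@coef_rows _ (fun n => n %% m)%N) => //.
- by move=> i j im; rewrite mulnC modnMDl modn_small.
- move=> n; split; first by rewrite ltn_mod.
  by exists (n %/ m)%N; rewrite mulnC -divn_eq.
move=> n i; rewrite /x_fin c0_sumE.
rewrite (@sum_indicator _ (fun k => m * k + n %% m)%N)// andbC mulnC -divn_eq.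
congr ((_ && _)%:R); apply/asboolP/eqP => [[k ->]|<-].
  by rewrite mulnC modnMDl modn_mod.
by exists (i %/ m)%N; rewrite mulnC -divn_eq.
Qed.

Lemma cs_infP (R : realType) (p : pairing) a :
  cs_inf R p a <-> row_cauchy predT (fun i j => p (i, j)) a.
Proof.
apply: (@coef_rows _ (fun n => (pair_decode p n).1)) => //.
- by move=> i j _; apply: pair_code_lt.
- by move=> i j _; rewrite pair_codeK.
- move=> n; split=> //; exists (pair_decode p n).2.
  by rewrite -surjective_pairing pair_decodeK.
move=> n i; rewrite /x_inf; case nE: (pair_decode p n) => [r j].
have -> : n = p (r, j) by rewrite -nE pair_decodeK.
rewrite c0_sumE (@sum_indicator _ (fun k => p (r, k))) 1?andbC; last first.
  by move=> k; exact: pair_code_lt.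
rewrite /=; congr ((_ && _)%:R).
apply/asboolP/eqP => [[k ->]|<-]; first by rewrite pair_codeK.
by exists (pair_decode p i).2; rewrite -surjective_pairing pair_decodeK.
Qed.

(** With finitely many rows uniformity is automatic. *)
Lemma row_cauchy_partial (R : realType) m (e : nat -> nat -> nat) (a : nat -> R) :
    (forall i j, (e i j < e i j.+1)%N) ->
  row_cauchy (fun i => i < m)%N e a <->
  forall j : 'I_m, cauchy_seq (fun k => \sum_(0 <= t < k) a (e j t)).
Proof.
move=> e_lt.
have cutE i k k' : (k <= k')%N -> \sum_(k <= t < k') a (e i t) =
    \sum_(0 <= t < k') a (e i t) - \sum_(0 <= t < k) a (e i t).
  by move=> kk'; rewrite [X in X - _](@big_cat_nat _ _ _ k)//= addrAC subrr add0r.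
split=> [aP j eps eps0|aP eps eps0].
  have [N NP] := aP eps eps0; exists N => k k' Nk Nk'.
  have Ne t : (N <= t)%N -> (N <= e j t)%N.
    by move=> Nt; exact: leq_trans Nt (enum_ge (e_lt j) t).
  have [kk'|/ltnW kk'] := leqP k k'.
    by rewrite distrC -cutE//; apply: NP => //; exact: Ne.
  by rewrite -cutE//; apply: NP => //; exact: Ne.
have /choice[N NP] : forall j : 'I_m, exists N, forall k k', (N <= k)%N -> (N <= k')%N ->
    `|\sum_(0 <= t < k) a (e j t) - \sum_(0 <= t < k') a (e j t)| <= eps.
  by move=> j; exact: aP.
exists (\max_(j < m) e j (N j)) => i p q im ep.
have Np : (N (Ordinal im) <= p)%N.
  have := leq_trans (leq_bigmax (F := fun j : 'I_m => e j (N j)) (Ordinal im)) ep.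
  by apply: contraTT; rewrite -!ltnNge (enum_ltn (e_lt i)).
have [qp|/ltnW pq] := leqP q p; first by rewrite big_geq// normr0 ltW.
by rewrite cutE// distrC; apply: (NP (Ordinal im)) => //; exact: leq_trans pq.
Qed.

(** * Reductions *)

(** Stated for a class [S] of subsets of a bare type, to serve both for Borel sets
    and for sets with the Baire property. *)
Lemma borel_preimage (Z : topologicalType) (T : Type) (S : set (set T)) (f : T -> Z) :
    S set0 -> (forall A, S A -> S (~` A)) ->
    (forall A : nat -> set T, (forall n, S (A n)) -> S (\bigcup_n A n)) ->
    (forall U, open U -> S (f @^-1` U)) ->
  forall B, borel_set B -> S (f @^-1` B).
Proof.
move=> S0 SC SU So B /(_ [set B | S (f @^-1` B)]); apply; split.
  split; first by rewrite /= preimage_set0.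
    by move=> A /= SA; rewrite setTD preimage_setC; exact: SC.
  by move=> A SA /=; rewrite preimage_bigcup; exact: SU.
by move=> U; exact: So.
Qed.

Lemma continuous_borel (Z W : topologicalType) (f : Z -> W) :
  continuous f -> borel_fun f.
Proof.
move=> /continuousP cf B; apply: (@borel_preimage _ _ (@borel_set Z)).
- exact: sigma_algebra0.
- by move=> A SA; rewrite /borel_set -setTD; exact: sigma_algebraCD.
- by move=> A SA; exact: sigma_algebra_bigcup.
- by move=> U oU; apply: sub_sigma_algebra; exact: cf.
Qed.

Lemma ptws_coord_continuous (R : realType) n :
  continuous (fun a : {ptws nat -> R} => a n).
Proof.
exact: (@proj_continuous nat (fun=> R) n).
Qed.

Lemma ptws_cvg (R : realType) (T : Type) (F : set_system T) (g : T -> {ptws nat -> R})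
    (a : {ptws nat -> R}) : Filter F ->
  (forall n, (fun t => g t n) @ F --> a n) -> g @ F --> a.
Proof.
move=> FF ga; apply/cvg_sup => n U [V] [[W] oW <-] Wa WU.
have Wan : nbhs (a n) W by apply: open_nbhs_nbhs; split.
have FW : F [set t | W (g t n)] := ga n _ Wan.
by apply: (@filterS _ F FF [set t | W (g t n)]) => // t Wt; exact: (WU (g t) Wt).
Qed.

(** All reductions below are linear of this diagonal form. *)
Definition rescale (R : realType) (c : nat -> R) (j : nat -> nat)
  (a : {ptws nat -> R}) : {ptws nat -> R} := fun n => c n * a (j n).

Lemma rescale_continuous (R : realType) c j : continuous (@rescale R c j).
Proof.
move=> a; apply: (@ptws_cvg R _ (nbhs a) (rescale c j) (rescale c j a)) => n.
have ja : (fun b : {ptws nat -> R} => b (j n)) @ a --> a (j n).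
  exact: ptws_coord_continuous.
apply: (@cvgM R _ (nbhs a) _ (fun=> c n) (fun b => b (j n)) (c n) (a (j n))) => //.
exact: cvg_cst.
Qed.

Lemma rescale_reduction (R : realType) (L L' : set (nat -> R)) c j :
  (forall a, L a <-> L' (rescale c j a)) -> borel_le (quot_rel L) (quot_rel L').
Proof.
move=> LL'; exists (rescale c j).
  by apply: continuous_borel; exact: rescale_continuous.
move=> a b; rewrite /quot_rel LL'.
suff -> : rescale c j (fun n => a n - b n) =
  (fun n => rescale c j a n - rescale c j b n) by [].
by apply/funext => n; rewrite /rescale mulrBr.
Qed.

(** The additional row is filled with zeros. *)
Lemma cs_fin_le_succ (R : realType) m : (0 < m)%N ->
  borel_le (quot_rel (cs_fin R m)) (quot_rel (cs_fin R m.+1)).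
Proof.
move=> m0; apply: (@rescale_reduction _ _ _
  (fun n => (n %% m.+1 < m)%N%:R) (fun n => m * (n %/ m.+1) + n %% m.+1)%N) => a.
rewrite !cs_finP//.
have coordE i j : (i < m.+1)%N -> rescale (fun n => (n %% m.+1 < m)%N%:R)
    (fun n => m * (n %/ m.+1) + n %% m.+1)%N a (m.+1 * j + i)%N =
    if (i < m)%N then a (m * j + i)%N else 0.
  move=> im; rewrite /rescale mulnC modnMDl modn_small// divnMDl// divn_small//.
  by rewrite addn0; case: ifP; rewrite ?mul1r ?mul0r.
split=> aP e e0; have [N NP] := aP e e0.
  exists (2 * N)%N => i p q im Np; under eq_bigr do rewrite coordE//.
  have [im'|im'] := ltnP i m; last by rewrite big1// normr0 ltW.
  by apply: NP => //; nia.
exists N => i p q im Np; have im1 : (i < m.+1)%N by exact: leqW.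
have := NP i p q im1; under eq_bigr do rewrite coordE// im.
by apply; nia.
Qed.

Lemma ler_sum_uniq (R : realType) (I : eqType) (s s' : seq I) (F : I -> R) :
    (forall i, 0 <= F i) -> uniq s -> {subset s <= s'} ->
  \sum_(i <- s) F i <= \sum_(i <- s') F i.
Proof.
move=> F0; elim: s s' => [|x s IH] s' us ss'; first by rewrite big_nil sumr_ge0.
have xs' : x \in s' by apply: ss'; rewrite mem_head.
case/andP: us => xs us; rewrite big_cons [leRHS](big_rem x)//= lerD2l.
apply: IH => // y ys; have : y \in s' by rewrite ss' ?inE ?ys ?orbT.
rewrite (perm_mem (perm_to_rem xs')) inE => /orP[/eqP yx|//].
by rewrite -yx ys in xs.
Qed.

Lemma ler_sum_head (R : realType) (F : nat -> R) N t q :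
  `|\sum_(t <= j < q) F j| <=
    \sum_(0 <= j < N) `|F j| + `|\sum_(maxn t N <= j < q) F j|.
Proof.
have [tN|/ltnW Nt] := leqP t N; last first.
  by rewrite lerDr sumr_ge0.
have sub u : (u <= N)%N -> `|\sum_(t <= j < u) F j| <= \sum_(0 <= j < N) `|F j|.
  move=> uN; apply: le_trans (ler_norm_sum _ _ _) _.
  apply: ler_sum_uniq; rewrite ?iota_uniq// => i.
  by rewrite !mem_index_iota /= => /andP[_ iu]; exact: leq_trans uN.
have [qN|/ltnW Nq] := leqP q N; first by rewrite ler_wpDr// sub.
rewrite (@big_cat_nat _ _ _ N)//=; apply: le_trans (ler_normD _ _) _.
by rewrite lerD2r sub.
Qed.

(** Row [i] carries the terms [a j * x j i] of the series in coordinate [i]. Both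
    conditions say that blocks of these series are uniformly small; they differ
    in what makes a block late, its position [j] or its code [p (i, j)]. The
    blocks with [j] small and [i] large are the only ones in dispute, and they
    are small because each [x j] is a null sequence. *)
Lemma coef_le_cs_inf (R : realType) (p : pairing) (x : nat -> c0 R) :
  borel_le (E_rel x) (quot_rel (cs_inf R p)).
Proof.
apply: (@rescale_reduction _ _ _
  (fun n => x (pair_decode p n).2 (pair_decode p n).1) (fun n => (pair_decode p n).2)) => a.
rewrite coefP cs_infP.
have coordE i j : rescale (fun n => x (pair_decode p n).2 (pair_decode p n).1)
    (fun n => (pair_decode p n).2) a (p (i, j)) = a j * x j i.
  by rewrite /rescale pair_codeK mulrC.
split=> aP e e0.
  have [N NP] := aP (e / 2) ltac:(lra).
  have [r rP] : exists r, forall i, (r <= i)%N ->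
      \sum_(0 <= j < N) `|a j * x j i| <= e / 2.
    elim: N (e / 2) (divr_gt0 e0 (ltr0n _ 2)) {NP} => [|N IH] d d0.
      by exists 0%N => i _; rewrite big_geq// ltW.
    have [r1 rP1] := IH (d / 2) ltac:(lra).
    have /null_seqP/(_ (d / 2) ltac:(lra))[r2 rP2] : null_seq R (fun i => a N * x N i).
      rewrite /null_seq/= -[0](mulr0 (a N)).
      by apply: cvgM; [exact: cvg_cst|exact: c0_cvg].
    exists (maxn r1 r2) => i; rewrite geq_max => /andP[/rP1 h1 /rP2 h2].
    by rewrite big_nat_recr//=; lra.
  exists (\max_(i < r) \max_(j < N) (p (val i, val j)).+1)%N => i t q _ Nt.
  under eq_bigr do rewrite coordE.
  have [ri|ir] := leqP r i.
    by apply: le_trans (ler_sum_head _ N t q) _; rewrite [e]splitr lerD ?rP ?NP ?leq_maxr.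
  have Nle : (N <= t)%N.
    rewrite leqNgt; apply/negP => tN.
    have h1 := @leq_bigmax _ (fun j : 'I_N => (p (i, val j)).+1) (Ordinal tN).
    have h2 := @leq_bigmax _ (fun i : 'I_r => \max_(j < N) (p (val i, val j)).+1)%N
      (Ordinal ir).
    by have := leq_trans (leq_trans h1 h2) Nt; rewrite ltnn.
  by have := NP t q i Nle; lra.
have [N NP] := aP e e0.
exists (\max_(n < N) (pair_decode p n).2.+1)%N => t q i Nt.
have := NP i t q isT; under eq_bigr do rewrite coordE; apply.
rewrite leqNgt; apply/negP => tN.
have := @leq_bigmax _ (fun n : 'I_N => (pair_decode p n).2.+1) (Ordinal tN).
by rewrite /= pair_codeK /=; move/leq_trans => /(_ _ Nt); rewrite ltnn.
Qed.

(** * Reducing null sequences to a coefficient space *)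

(** On finitely many coordinates the [v n] range over a bounded set of finite
    dimension, which is covered by finitely many cells of size [eps]. *)
Lemma pigeonhole_close (R : realType) (v : nat -> nat -> R) :
    (forall n i, `|v n i| <= 1) ->
  forall M eps n0, 0 < eps -> exists a b, [/\ (n0 <= a)%N, (a < b)%N &
    forall i, (i < M)%N -> `|v a i - v b i| <= eps].
Proof.
move=> v1 M eps n0 eps0; pose t n i := Num.truncn ((v n i + 1) / eps).
pose B := Num.truncn (2 / eps).
have v_ge0 n i : 0 <= (v n i + 1) / eps.
  by apply: divr_ge0; last exact: ltW; have := v1 n i; rewrite ler_norml; lra.
have tB n i : (t n i < B.+1)%N.
  rewrite ltnS /t /B; apply: Num.Theory.le_truncn; rewrite ler_pM2r ?invr_gt0//.
  by have := v1 n i; rewrite ler_norml; lra.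
have tP n n' i : t n i = t n' i -> `|v n i - v n' i| <= eps.
  move=> tt; have /andP[l1 u1] := Num.Theory.truncn_itv (v_ge0 n i).
  have /andP[l2 u2] := Num.Theory.truncn_itv (v_ge0 n' i).
  have : `|(v n i + 1) / eps - (v n' i + 1) / eps| <= 1.
    rewrite -/(t n i) tt -natr1 in l1 u1; rewrite -/(t n' i) -natr1 in l2 u2.
    move: l1 u1 l2 u2; move: (_ / eps) (_ / eps) (_%:R) => X Y Z.
    by rewrite ler_norml; lra.
  rewrite -mulrBl normrM normfV (gtr0_norm eps0) ler_pdivrMr// mul1r.
  by have -> : v n i + 1 - (v n' i + 1) = v n i - v n' i by ring.
pose phi (k : 'I_(#|{ffun 'I_M -> 'I_B.+1}|.+1)) : {ffun 'I_M -> 'I_B.+1} :=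
  [ffun i : 'I_M => Ordinal (tB (n0 + k)%N i)].
have /injectivePn[k [k' kk' phik]] : ~~ injectiveb phi.
  by apply/negP => /injectiveP/leq_card; rewrite card_ord ltnn.
have close i : (i < M)%N -> `|v (n0 + k)%N i - v (n0 + k')%N i| <= eps.
  move=> iM; apply: tP; have /ffunP/(_ (Ordinal iM)) := phik.
  by rewrite !ffunE => -[].
have [lt|lt|eq] := ltngtP k k'; last by move: kk'; rewrite -val_eqE /= eq eqxx.
  by exists (n0 + k)%N, (n0 + k')%N; rewrite leq_addr ltn_add2l.
exists (n0 + k')%N, (n0 + k)%N; rewrite leq_addr ltn_add2l; split=> // i iM.
by rewrite distrC; exact: close.
Qed.

Section Blocks.
Variables (R : realType) (v : nat -> nat -> R).
Hypothesis v_le1 : forall n i, `|v n i| <= 1.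
Hypothesis v_null : forall n, null_seq R (v n).

(** Up to [2^-1 ^+ k], the difference [v (A k) - v (B k)] lives on the coordinates
    between [M k] and [M k.+1]: it is small below by the pigeonhole principle,
    and small above because it is a null sequence. *)
Lemma near_block_pairs : exists A B M : nat -> nat,
  [/\ forall k, (A k < B k)%N, forall k, (B k < A k.+1)%N,
      forall k, (M k <= M k.+1)%N
    & forall k i, (i < M k)%N || (M k.+1 <= i)%N ->
      `|v (A k) i - v (B k) i| <= 2^-1 ^+ k].
Proof.
have /choice[next nextP] : forall s : nat * (nat * nat), exists t : nat * nat * nat,
    let: (k, (n, M)) := s in let: (a, b, M') := t in
    [/\ (n <= a)%N, (a < b)%N, (M <= M')%N & forall i, (i < M)%N || (M' <= i)%N ->
      `|v a i - v b i| <= 2^-1 ^+ k].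
  move=> [k [n M]]; have e0 : 0 < (2^-1 : R) ^+ k by rewrite exprn_gt0// invr_gt0.
  have [a [b [na ab close]]] := pigeonhole_close v_le1 M n e0.
  have /null_seqP/(_ _ (divr_gt0 e0 (ltr0n _ 2)))[M1 M1P] := v_null a.
  have /null_seqP/(_ _ (divr_gt0 e0 (ltr0n _ 2)))[M2 M2P] := v_null b.
  exists (a, b, maxn M (maxn M1 M2)); split=> //; first by rewrite leq_maxl.
  move=> i /orP[/close //|]; rewrite !geq_max => /and3P[_ /M1P h1 /M2P h2].
  by apply: le_trans (ler_normB _ _) _; lra.
pose st := fix st k : nat * nat * nat :=
  next (k, if k is k'.+1 then ((st k').1.2.+1, (st k').2) else (0, 0)%N).
pose A k := (st k).1.1; pose B k := (st k).1.2.
pose M k := if k is k'.+1 then (st k').2 else 0%N.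
have stP k : [/\ ((if k is k'.+1 then (B k').+1 else 0) <= A k)%N, (A k < B k)%N,
    (M k <= M k.+1)%N & forall i, (i < M k)%N || (M k.+1 <= i)%N ->
      `|v (A k) i - v (B k) i| <= 2^-1 ^+ k].
  have := nextP (k, if k is k'.+1 then ((st k').1.2.+1, (st k').2) else (0, 0)%N).
  rewrite (_ : next _ = st k); last by case: k.
  by rewrite /A /B /M; case: k => [|k]; case: (st _) => [[? ?] ?].
exists A, B, M; split=> k; first by have [] := stP k.
- by have [] := stP k.+1.
- by have [] := stP k.
by have [] := stP k.
Qed.

(** At most one [k] has [i] in its block, contributing at most [2]; the other terms
    add up to at most [2]. *)
Lemma block_sum_bound (A B M : nat -> nat) i n :
    (forall k, (M k <= M k.+1)%N) ->
    (forall k i, (i < M k)%N || (M k.+1 <= i)%N ->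
      `|v (A k) i - v (B k) i| <= 2^-1 ^+ k) ->
  \sum_(0 <= k < n) `|v (A k) i - v (B k) i| <= 4.
Proof.
move=> M_le close.
(* The contribution [2] is not yet spent as long as [i < M n]. *)
suff : \sum_(0 <= k < n) `|v (A k) i - v (B k) i| + 2 * 2^-1 ^+ n <=
    2 + 2 * (i < M n)%N%:R.
  have : (0 : R) <= 2^-1 ^+ n by rewrite exprn_ge0// invr_ge0.
  by case: (i < M n)%N => /=; lra.
elim: n => [|n IH].
  by rewrite big_geq// expr0; case: (i < M 0)%N => /=; lra.
rewrite big_nat_recr//= exprS.
have le2 : `|v (A n) i - v (B n) i| <= 2.
  by apply: le_trans (ler_normB _ _) _; have := lerD (v_le1 (A n) i) (v_le1 (B n) i).
have pn : (0 : R) <= 2^-1 ^+ n by rewrite exprn_ge0// invr_ge0.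
have := close n i; move: IH (M_le n); case: (ltnP i (M n)) => /= [iM IH MM|iM IH MM].
  by rewrite (leq_trans iM MM) => /(_ isT) /=; lra.
case: (ltnP i (M n.+1)) => /= iM' h; first by lra.
by have := h isT; lra.
Qed.

End Blocks.

(** The reduction maps [a] to the coefficients [a k] at [A k] and [- a k] at [B k],
    relative to the normalised vectors [v]. If [a] tends to [0], the paired sums
    converge since the differences are nearly disjoint blocks, and unpaired terms
    are small. If the series converges, its terms tend to [0], and the term at
    [A k] has norm [`|a k|]. *)
Lemma null_le_coef (R : realType) (x : nat -> c0 R) : (forall n, x n != 0) ->
  borel_le (quot_rel (null_seq R)) (E_rel x).
Proof.
move=> x0; have nx n : 0 < `|x n| by rewrite normr_gt0.
pose v n i := x n i / `|x n|.
have v_le1 n i : `|v n i| <= 1.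
  rewrite /v normrM normfV (gtr0_norm (nx n)) ler_pdivrMr// mul1r.
  exact: c0_norm_ge.
have v_null n : null_seq R (v n).
  rewrite /null_seq /= -(mul0r (`|x n|^-1)).
  by apply: cvgM; [exact: c0_cvg|exact: cvg_cst].
have [A [B [M [AB BA M_le close]]]] := near_block_pairs v_le1 v_null.
pose e t := if odd t then B t./2 else A t./2.
have e_lt t : (e t < e t.+1)%N.
  by rewrite /e /= uphalf_half; case: (odd t); rewrite ?add1n ?add0n.
have e_even k : e k.*2 = A k by rewrite /e odd_double doubleK.
have e_odd k : e k.*2.+1 = B k by rewrite /e /= odd_double uphalf_double.
pose cnt := enum_count e_lt.
pose c n := if e (cnt n) == n then (-1) ^+ cnt n / `|x n| else 0.
apply: (@rescale_reduction _ _ _ c (fun n => (cnt n)./2)) => a.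
pose F i t := (-1) ^+ t * a t./2 * v (e t) i.
have sumE p q i : \sum_(p <= n < q) rescale c (fun n => (cnt n)./2) a n * x n i =
    \sum_(cnt p <= t < cnt q) F i t.
  have eP n : e (cnt n) == n <-> exists t, n = e t.
    by split=> [/eqP <-|[t ->]]; [exists (cnt n)|rewrite /cnt enum_count_enum].
  have := sum_enum e_lt eP (fun n => rescale c (fun n => (cnt n)./2) a n * x n i) p q.
  rewrite big_mkcond => sE; transitivity (\sum_(cnt p <= j < cnt q)
    rescale c (fun n => (cnt n)./2) a (e j) * x (e j) i).
    rewrite -sE; apply: eq_bigr => n _; case: ifP => // ne.
    by rewrite /rescale /c ne !mul0r.
  apply: eq_bigr => t _; rewrite /rescale /c /cnt enum_count_enum eqxx /F /v.
  by field; rewrite gt_eqF.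
rewrite null_seqP coefP; split=> aP eps eps0; last first.
  have [N NP] := aP eps eps0; exists N => k Nk.
  have Np : (N <= A k)%N.
    by rewrite -e_even (leq_trans _ (enum_ge e_lt _))// -addnn (leq_trans Nk)// leq_addr.
  rewrite -[`|a k|]mulr1 -(@divff _ `|x (A k)|) ?gt_eqF// mulrA.
  rewrite mulrAC -[X in _ / X](gtr0_norm (nx (A k))) -normf_div.
  rewrite -[leLHS](c0_normZ (a k / `|x (A k)|) (x (A k))).
  apply: c0_norm_le => i; have := NP (A k) (A k).+1 i Np; rewrite sumE.
  have -> : cnt (A k) = k.*2 by rewrite -e_even /cnt enum_count_enum.
  have -> : cnt (A k).+1 = k.*2.+1.
    apply/eqP; rewrite eqn_leq /cnt enum_count_leq e_odd AB /=.
    by rewrite enum_countP e_even.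
  rewrite big_nat1 /F e_even doubleK -signr_odd odd_double expr0 mul1r.
  have -> : (a k / `|x (A k)| *: x (A k) : c0 R) i = a k * v (A k) i.
    by rewrite -[LHS]/(a k / `|x (A k)| * x (A k) i) /v mulrA mulrAC.
  by [].
have [K KP] := aP (eps / 10) ltac:(lra).
have F_le i t : (K.*2 <= t)%N -> `|F i t| <= eps / 10.
  move=> Kt; have -> : `|F i t| = `|a t./2| * `|v (e t) i|.
    by rewrite /F -mulrA normrM normrX normrN1 expr1n mul1r normrM.
  have Kt2 : (K <= t./2)%N by rewrite -(doubleK K) half_leq.
  rewrite -[leRHS]mulr1; by apply: ler_pM; rewrite // ?KP// v_le1.
have even_sum i k : (K <= k)%N -> `|\sum_(K.*2 <= t < k.*2) F i t| <= 4 * (eps / 10).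
  move=> Kk; have -> : \sum_(K.*2 <= t < k.*2) F i t =
      \sum_(K <= j < k) a j * (v (A j) i - v (B j) i).
    elim: k Kk => [|k IH]; first by rewrite leqn0 => /eqP ->; rewrite !big_geq.
    rewrite leq_eqVlt => /orP[/eqP <-|]; first by rewrite !big_geq.
    rewrite ltnS => Kk; rewrite doubleS !big_nat_recr ?leqW ?leq_double//= IH//.
    rewrite -addrA; congr (_ + _).
    rewrite /F e_even e_odd doubleK /= uphalf_double exprS -signr_odd odd_double.
    by rewrite expr0; ring.
  apply: le_trans (ler_norm_sum _ _ _) _.
  apply: (@le_trans _ _ (eps / 10 * \sum_(K <= j < k) `|v (A j) i - v (B j) i|)).
    rewrite mulr_sumr !big_nat; apply: ler_sum => j /andP[Kj _].
    by rewrite normrM ler_wpM2r// KP.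
  rewrite mulrC ler_wpM2r//; first by lra.
  apply: le_trans (block_sum_bound v_le1 i k M_le close).
  apply: ler_sum_uniq; rewrite ?iota_uniq// => j.
  by rewrite !mem_index_iota /= => /andP[].
have tail i T : (K.*2 <= T)%N -> `|\sum_(K.*2 <= t < T) F i t| <= eps / 2.
  move=> KT; have := odd_double_half T; case: (odd T) => /= TE.
    rewrite -TE add1n big_nat_recr/=; last by lia.
    have := even_sum i T./2; have := F_le i T./2.*2.
    have -> : (K.*2 <= T./2.*2)%N by lia.
    have -> : (K <= T./2)%N by lia.
    move=> /(_ isT) h1 /(_ isT) h2.
    by apply: le_trans (ler_normD _ _) _; lra.
  rewrite -TE add0n; have := even_sum i T./2; have -> : (K <= T./2)%N by lia.
  by move=> /(_ isT); lra.
exists (e K.*2) => p q i Kp; rewrite sumE.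
have Kcp : (K.*2 <= cnt p)%N.
  by rewrite -[K.*2](enum_count_enum e_lt); exact: enum_count_homo.
have [qp|/ltnW pq] := leqP (cnt q) (cnt p); first by rewrite big_geq// normr0 ltW.
have := tail i (cnt q) (leq_trans Kcp pq); have := tail i _ Kcp.
by rewrite (@big_cat_nat _ _ _ (cnt p) K.*2 (cnt q))//= !ler_norml; lra.
Qed.

(** * Normal form of a Borel reduction *)

Section NormalForm.
Variables (R : realType) (J : finType).

Variables (L : set (nat -> R)) (I : pred nat) (e : nat -> nat -> nat).
Variables (rowof colof : nat -> nat).
Hypothesis LP : forall a, L a <-> row_cauchy I e a.
Hypothesis e_lt : forall i j, (e i j < e i j.+1)%N.
Hypothesis rowofE : forall i j, I i -> rowof (e i j) = i.
Hypothesis colofE : forall i j, I i -> colof (e i j) = j.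

(** The target space is described by finitely many sequences of continuous
    functionals, such as partial sums. *)
Variables (L' : set (nat -> R)) (phi : J -> nat -> {ptws nat -> R} -> R).
Hypothesis L'P : forall b b' : {ptws nat -> R}, quot_rel L' b b' <->
  forall j, cauchy_seq (fun k => phi j k b - phi j k b').
Hypothesis phi_cont : forall j k, continuous (phi j k).

(** A digit of label [l] contributes [wt l] to row [row l]. Every label is carried
    by infinitely many digits, so that the fusion can choose its position with
    label [l] in step [l]. *)
Variables (row : nat -> nat) (wt : nat -> R) (lab : nat -> nat).
Hypothesis row_I : forall l, I (row l).
Hypothesis lab_inf : forall l N, exists2 n, (N <= n)%N & lab n = l.

Variable theta : {ptws nat -> R} -> {ptws nat -> R}.
Hypothesis theta_borel : borel_fun theta.
Hypothesis thetaP : forall a b, quot_rel L a b <-> quot_rel L' (theta a) (theta b).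

(** A copy of the Cantor space in the source: digit [j] is written in column [j] of
    the row of its label. *)
Definition encode (x : bits) : {ptws nat -> R} := fun n =>
  if row (lab (colof n)) == rowof n then (x (colof n))%:R * wt (lab (colof n)) else 0.

Let encodeE x i j : I i -> encode x (e i j) =
  if row (lab j) == i then (x j)%:R * wt (lab j) else 0.
Proof. by move=> Ii; rewrite /encode rowofE// colofE. Qed.

Let e_ge i j : (j <= e i j)%N.
Proof. exact: enum_ge. Qed.

Let e_homo i j k : (j <= k)%N -> (e i j <= e i k)%N.
Proof. by move=> jk; rewrite leqNgt (enum_ltn (e_lt i)) -leqNgt. Qed.

(** [encode] is continuous since each coordinate of the image depends on one
    digit. *)
Lemma encode_preimage s B : borel_set B ->
  baire_property ((encode \o overwrite s) @^-1` B).
Proof.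
apply: (@borel_preimage _ _ baire_property).
- exact: baire_property0.
- exact: baire_propertyC.
- exact: baire_property_bigcup.
move=> U oU; apply: baire_property_open => x Ux.
pose F : set_system bits := [set P | exists N, forall x', agree N x x' -> P x'].
have FF : Filter F.
  split; first by exists 0%N.
    move=> P Q [N NP] [M MQ]; exists (maxn N M) => x' xx'; split.
      by apply/NP/(agree_le _ xx'); rewrite leq_maxl.
    by apply/MQ/(agree_le _ xx'); rewrite leq_maxr.
  by move=> P Q PQ [N NP]; exists N => x' /NP/PQ.
have : (encode \o overwrite s) @ F --> (encode \o overwrite s) x.
  apply: ptws_cvg => n W /nbhs_singleton Wn; exists (colof n).+1 => x' xx'.
  rewrite /preimage /= /encode (_ : overwrite s x' (colof n) = overwrite s x (colof n))//.
  by apply/esym/(agree_overwrite _ xx').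
by move=> /(_ U); apply; apply: open_nbhs_nbhs.
Qed.

Let f j k x := phi j k (theta (encode x)).

Let f_measurable j k s : measurable_fun setT (f j k \o overwrite s).
Proof.
apply: (measurability _ (RGenOpens.measurableE R)) => _ [_ [a [b ->] <-]].
rewrite setTI.
have oU : open (phi j k @^-1` `]a, b[%classic).
  by move/continuousP: (@phi_cont j k); apply; exact: interval_open.
have bU : borel_set (phi j k @^-1` `]a, b[%classic) by exact: sub_sigma_algebra.
exact: (encode_preimage s (theta_borel bU)).
Qed.

(** A finite change of the digits changes [encode x] in finitely many coordinates,
    hence within [L]. *)
Let f_cauchy j x s s' : size s = size s' ->
  cauchy_seq (fun k => f j k (overwrite s x) - f j k (overwrite s' x)).
Proof.
move=> ss'; move: j; apply/L'P/thetaP/LP => eps eps0.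
exists (\max_(j < size s) (e (row (lab j)) j).+1)%N => i p q Ii Np.
rewrite big_nat big1 ?normr0 ?ltW// => j /andP[pj _].
rewrite !encodeE//; case: eqP => ij; last by rewrite subrr.
suff sj : (size s <= j)%N by rewrite /overwrite -ss' ltnNge sj subrr.
rewrite leqNgt; apply/negP => js.
have := @leq_bigmax _ (fun j : 'I_(size s) => (e (row (lab j)) j).+1) (Ordinal js).
rewrite /= ij => /leq_trans/(_ Np)/leq_trans/(_ (e_homo i pj)).
by rewrite ltnn.
Qed.

(** The condition [row_cauchy] read on the labels instead of the indices, see
    [plant_small]. *)
Definition small (z : bits) := forall eps, 0 < eps -> exists N, forall i p q,
  (N <= p)%N -> `|\sum_(p <= l < q | row l == i) (z l)%:R * wt l| <= eps.

(** Only finitely many selected indices carry a label below a given bound, and an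
    index is never below its label; so late blocks are the same for indices and
    for labels. *)
Let plant_small y pos z : (forall l, (pos l < pos l.+1)%N) ->
    (forall l, lab (pos l) = l) -> (forall l, y (pos l) = false) ->
  quot_rel L (encode (plant y pos z)) (encode y) <-> small z.
Proof.
move=> pos_lt labpos ypos.
pose d : nat -> R := fun n => encode (plant y pos z) n - encode y n.
have plant_out n : (forall l, n <> pos l) -> plant y pos z n = y n.
  by move=> nl; rewrite /plant; case: asboolP; rewrite ?orbF// => -[l ln]; case: (nl l).
have plant_pos l : plant y pos z (pos l) = z l.
  rewrite /plant ypos /=; apply/asboolP/idP => [[k /(enum_inj pos_lt) ->]//|zl].
  by exists l.
pose cnt := enum_count pos_lt.
have posP n : pos (cnt n) == n <-> exists l, n = pos l.
  by split=> [/eqP <-|[t ->]]; [exists (cnt n)|rewrite /cnt enum_count_enum].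
have dE i p q : I i -> \sum_(p <= j < q) d (e i j) =
    \sum_(cnt p <= l < cnt q | row l == i) (z l)%:R * wt l.
  move=> Ii; rewrite [RHS]big_mkcond/=.
  transitivity (\sum_(cnt p <= l < cnt q) d (e i (pos l))); last first.
    apply: eq_bigr => l _; rewrite /d !encodeE// labpos plant_pos ypos mul0r.
    by case: ifP; rewrite subr0.
  rewrite -(sum_enum pos_lt posP (d \o e i)) [RHS]big_mkcond/=.
  apply: eq_bigr => j _; case: ifPn => // /negP nj.
  by rewrite /d !encodeE// plant_out ?subrr// => l jl; apply/nj/posP; exists l.
rewrite /quot_rel LP -/d; split=> dP eps eps0; have [N NP] := dP eps eps0.
  exists N => i p q Np.
  have [[l0 l0i]|ni] := pselect (exists l, row l = i); last first.
    by rewrite big1 ?normr0 ?ltW// => l /eqP li; case: ni; exists l.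
  have Ii : I i by rewrite -l0i.
  have := NP i (pos p) (pos q) Ii; rewrite dE// /cnt !enum_count_enum; apply.
  exact: leq_trans Np (leq_trans (enum_ge pos_lt p) (e_ge i (pos p))).
exists (\max_(l < N) (e (row l) (pos l)).+1)%N => i p q Ii Np; rewrite dE//.
suff -> : \sum_(cnt p <= l < cnt q | row l == i) (z l)%:R * wt l =
    \sum_(maxn N (cnt p) <= l < cnt q | row l == i) (z l)%:R * wt l.
  by apply: NP; rewrite leq_maxl.
rewrite [RHS](@big_nat_widenl _ _ _ _ (cnt p)) ?leq_maxr//.
rewrite [LHS]big_nat_cond [RHS]big_nat_cond; apply: eq_bigl => l.
have [/andP[pl _]|_] := boolP (cnt p <= l < cnt q)%N; last by [].
rewrite /=; case: eqP => //= li.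
apply/esym; rewrite geq_max pl andbT leqNgt; apply/negP => lN.
have ppl : (p <= pos l)%N by rewrite -(enum_count_leq pos_lt).
have := @leq_bigmax _ (fun l : 'I_N => (e (row l) (pos l)).+1) (Ordinal lN).
rewrite /= li => /leq_trans/(_ Np)/leq_trans/(_ (e_homo i ppl)).
by rewrite ltnn.
Qed.

(** A Borel reduction of [R^N / L] to [R^N / L'] translates [small] into a
    condition on a sequence that is, up to summable errors, a sum of
    independent contributions of the digits. *)
Lemma normal_form : exists (K : nat -> nat) (h : J -> nat -> nat -> R)
    (s : bits -> J -> nat -> R),
  [/\ forall l, (K l < K l.+1)%N,
      forall z j l k, (K l <= k <= K l.+1)%N ->
        `|s z j k - s z j (K l) - (z l)%:R * h j l k| <= 3 * 2^-1 ^+ l,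
      forall z, small z <-> forall j, cauchy_seq (s z j)
    & forall z j k, exists b b', s z j k = phi j k b - phi j k b'].
Proof.
have [y [pos [K [h [pos_lt labpos ypos K_lt sh]]]]] :=
  stabilization f_measurable f_cauchy lab_inf.
exists K, h, (fun z j k => f j k (plant y pos z) - f j k y); split => //.
- by move=> z j l k; exact: sh.
- by move=> z; rewrite -(plant_small z pos_lt labpos ypos) thetaP L'P.
- by move=> z j k; exists (theta (encode (plant y pos z))), (theta (encode y)).
Qed.

End NormalForm.

(** * Non-reducibility *)

Section InfinitelyOften.
Variables (p : pairing).

Lemma pair_code_ge i j : (j <= p (i, j))%N.
Proof. by apply: (@enum_ge (fun j => p (i, j))) => k; exact: pair_code_lt. Qed.

Definition pair_row n := (pair_decode p n).1.

Lemma pair_row_inf l N : exists2 n, (N <= n)%N & pair_row n = l.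
Proof.
by exists (p (l, N)); rewrite ?pair_code_ge// /pair_row pair_codeK.
Qed.

End InfinitelyOften.

(** No reduction of [cs_fin] to null sequences: a sequence that tends to [0] and
    has contributions [h l] must have [h l] tending to [0], and conversely this
    suffices whatever digits are selected. The alternating harmonic series, which
    converges with all its terms but diverges with the positive ones only, shows
    that [small] behaves otherwise. *)
Section NotLeNull.
Variables (R : realType) (p : pairing) (m : nat).
Hypothesis m_gt0 : (0 < m)%N.

Definition alternating_harmonic (l : nat) : R := (-1) ^+ l / (l./2.+1)%:R.

(** Interleaving with zeros turns convergence to [0] into mere convergence. *)
Let interleave0 (j : unit) (k : nat) (b : {ptws nat -> R}) : R :=
  if odd k then 0 else b k./2.

Let interleave0_cont j k : continuous (interleave0 j k).
Proof.
rewrite /interleave0; case: (odd k); last exact: (@ptws_coord_continuous R k./2).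
exact: (@cst_continuous {ptws nat -> R} R 0).
Qed.

Let interleave0_cauchy (s : nat -> R) : (forall k, odd k -> s k = 0) ->
  cauchy_seq s <-> null_seq R s.
Proof.
move=> s0; split=> [cs|/null_seqP sn].
  apply/null_seqP => e /cs[N NP]; exists N => n Nn.
  have [k Nk ok] : exists2 k, (N <= k)%N & odd k.
    by exists N.*2.+1; rewrite /= ?odd_double// -addnn ltnW// ltnS leq_addr.
  by have := NP n k Nn Nk; rewrite (s0 k ok) subr0.
move=> e e0; have [N NP] := sn (e / 2) ltac:(lra).
exists N => k k' /NP h /NP h'; apply: le_trans (ler_normB _ _) _; lra.
Qed.

Let nullP (b b' : {ptws nat -> R}) : quot_rel (null_seq R) b b' <->
  forall j, cauchy_seq (fun k => interleave0 j k b - interleave0 j k b').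
Proof.
have odd0 j k : odd k -> interleave0 j k b - interleave0 j k b' = 0.
  by rewrite /interleave0 => ->; rewrite subrr.
rewrite /quot_rel; split=> [/null_seqP bP j|/(_ tt)].
  apply/(interleave0_cauchy (odd0 j))/null_seqP => e e0; have [N NP] := bP e e0.
  exists N.*2 => k Nk; rewrite /interleave0; case: ifP => ok.
    by rewrite subrr normr0 ltW.
  by apply: NP; rewrite -(doubleK N) half_leq.
move=> /(interleave0_cauchy (odd0 tt))/null_seqP bP.
apply/null_seqP => e e0; have [N NP] := bP e e0.
exists N => k Nk; have := NP k.*2; rewrite /interleave0 odd_double doubleK; apply.
by rewrite -addnn (leq_trans Nk)// leq_addr.
Qed.

Let alternating_sum n : \sum_(0 <= l < n) alternating_harmonic l =
  if odd n then (n./2.+1)%:R^-1 else 0.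
Proof.
elim: n => [|n IH]; first by rewrite big_geq.
rewrite big_nat_recr//= IH /alternating_harmonic uphalf_half -signr_odd.
case: (odd n); rewrite /= ?add0n ?add0r; first by rewrite expr1; ring.
by rewrite expr0 mul1r.
Qed.

Let small0 := small (fun=> 0%N) alternating_harmonic.

Let small_all : small0 xpredT.
Proof.
move=> e e0; pose N := Num.truncn (2 / e).
have NP n : (N.*2 <= n)%N -> `|\sum_(0 <= l < n) alternating_harmonic l| <= e / 2.
  move=> Nn; rewrite alternating_sum; case: ifP => _; last by rewrite normr0; lra.
  have Nn2 : (N <= n./2)%N by rewrite -(doubleK N) half_leq.
  rewrite ger0_norm ?invr_ge0// -[leRHS]invrK lef_pV2 ?posrE ?invr_gt0 ?divr_gt0//.
  rewrite invf_div (le_trans (ltW (Num.Theory.truncnS_gt _)))// ler_nat ltnS.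
  exact: leq_trans Nn2.
exists N.*2 => i a b Na; have [_|i0] := eqVneq i 0%N; last first.
  by rewrite big_pred0 ?normr0 ?ltW// => l; rewrite eq_sym (negbTE i0).
under eq_bigr do rewrite mul1r.
have [ba|/ltnW ab] := leqP b a; first by rewrite big_geq// normr0 ltW.
have := NP _ Na; have := NP _ (leq_trans Na ab).
by rewrite (@big_cat_nat _ _ _ a 0 b)//= !ler_norml; lra.
Qed.

Let not_small_even : ~ small0 (fun l => ~~ odd l).
Proof.
move=> sm; apply: (@dvg_harmonic R); apply/cauchy_cvgP/cauchy_seriesP => e e0.
have [N NP] := sm (e / 2) ltac:(lra).
exists ([set n | (N <= n)%N], setT); first by split; [exists N|exact: filterT].
move=> [a b] /= [Na _]; apply: (@le_lt_trans _ _ (e / 2)); last by lra.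
suff -> : \sum_(a <= k < b) harmonic k =
    \sum_(a.*2 <= l < b.*2 | 0%N == 0%N) (~~ odd l)%:R * alternating_harmonic l.
  by apply: NP; rewrite (leq_trans Na)// -addnn leq_addr.
have [ba|/ltnW ab] := leqP b a; first by rewrite !big_geq ?leq_double.
elim: b ab => [|b IH]; first by rewrite leqn0 => /eqP ->; rewrite !big_geq.
rewrite leq_eqVlt => /orP[/eqP <-|]; first by rewrite !big_geq.
rewrite ltnS => ab; rewrite doubleS big_nat_recr//= IH// [RHS]big_nat_recr ?leqW ?leq_double//.
rewrite big_nat_recr ?leq_double//= odd_double mul0r addr0 mul1r; congr (_ + _).
by rewrite /alternating_harmonic -signr_odd odd_double doubleK expr0 mul1r.
Qed.

Lemma cs_fin_not_le_null : ~ borel_le (quot_rel (cs_fin R m)) (quot_rel (null_seq R)).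
Proof.
case=> theta bt tP.
pose e i j := (m * j + i)%N.
have e_lt i j : (e i j < e i j.+1)%N by rewrite /e; lia.
have rowE i j : (i < m)%N -> (e i j %% m)%N = i.
  by move=> im; rewrite /e mulnC modnMDl modn_small.
have colE i j : (i < m)%N -> (e i j %/ m)%N = j.
  by move=> im; rewrite /e mulnC divnMDl// divn_small// addn0.
have [K [h [s [K_lt sh sP sphi]]]] := normal_form (rowof := fun n => (n %% m)%N)
  (colof := fun n => (n %/ m)%N) (row := fun=> 0%N) (fun a => @cs_finP R m a m_gt0)
  e_lt rowE colE nullP interleave0_cont alternating_harmonic (fun=> m_gt0)
  (@pair_row_inf p) bt tP.
have s_odd z k : odd k -> s z tt k = 0.
  by move=> ok; have [b [b' ->]] := sphi z tt k; rewrite /interleave0 ok subrr.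
have [osc _] := cauchy_increments K_lt (sh xpredT tt) ((sP _).1 small_all tt).
apply: not_small_even; apply/sP => -[]; set z := fun l => _.
apply/(interleave0_cauchy (s_odd z))/null_seqP => eps eps0.
have [N1 N1P] := osc (eps / 4) ltac:(lra).
have [N2 N2P] := @half_pow_small R (eps / 12) ltac:(lra).
exists (K (maxn N1 N2)) => k Nk.
have [l [Nl lk]] := interval_of K_lt Nk.
(* The interval contains a place [k'] of an interleaved zero. *)
have [k' [lk' ok']] : exists k', (K l <= k' <= K l.+1)%N /\ odd k'.
  case ol : (odd (K l)); first by exists (K l); rewrite leqnn ltnW.
  by exists (K l).+1; rewrite leqnSn K_lt /= ol.
have h1 k0 : (K l <= k0 <= K l.+1)%N -> `|(z l)%:R * h tt l k0| <= eps / 4.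
  move=> lk0; have := N1P l k0; rewrite (leq_trans _ Nl) ?leq_maxl// mul1r.
  move=> /(_ isT lk0); case: (z l); rewrite ?mul1r// mul0r normr0 => _; lra.
have h2 := N2P l (leq_trans (leq_maxr _ _) Nl).
have kl : (K l <= k <= K l.+1)%N by case/andP: lk => -> /ltnW.
move: (h1 _ kl) (h1 _ lk') (sh z tt l k kl) (sh z tt l k' lk').
by rewrite (s_odd z k' ok') !ler_norml; lra.
Qed.

End NotLeNull.

(** The combinatorics for [cs_inf]: row [p (q, i)] consists of labels of weight
    [1 / (q + 1)], so that selecting one label per row, and finitely many for each
    [q], produces small elements, whereas [q + 1] labels of one row add up to
    [1]. *)
Section NotLeFinite.
Variables (R : realType) (p : pairing) (m : nat).
Hypothesis m_gt0 : (0 < m)%N.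

Definition label q i c := p (p (q, i), c).
Definition label_q l := pair_row p (pair_row p l).
Definition label_i l := (pair_decode p (pair_row p l)).2.
Definition label_c l := (pair_decode p l).2.
Definition label_wt l : R := (label_q l).+1%:R^-1.

Lemma labelK q i c : [/\ pair_row p (label q i c) = p (q, i),
  label_q (label q i c) = q, label_i (label q i c) = i & label_c (label q i c) = c].
Proof.
by rewrite /label_q /label_i /label_c /label /pair_row !pair_codeK.
Qed.

Lemma label_decode l : label (label_q l) (label_i l) (label_c l) = l.
Proof.
rewrite /label /label_q /label_i /label_c {1}/pair_row -surjective_pairing.
by rewrite pair_decodeK /pair_row -surjective_pairing pair_decodeK.
Qed.

Local Notation small := (small (pair_row p) label_wt).

Definition sparse (z : bits) :=
  (forall l l', z l -> z l' -> pair_row p l = pair_row p l' -> l = l') /\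
  (forall Q, exists N, forall l, z l -> (label_q l < Q)%N -> (l < N)%N).

(** A sum with at most one nonzero term. *)
Lemma sum_single (F : nat -> R) (P : pred nat) eps a b : 0 < eps ->
    (forall l l', P l -> P l' -> F l != 0 -> F l' != 0 -> l = l') ->
    (forall l, (a <= l)%N -> P l -> `|F l| <= eps) ->
  `|\sum_(a <= l < b | P l) F l| <= eps.
Proof.
move=> eps0 F1 Fe; rewrite big_mkcond.
have [[l lab [Pl Fl]]|nl] := pselect (exists2 l, (a <= l < b)%N & P l /\ F l != 0).
  rewrite (bigD1_seq l) ?mem_index_iota ?iota_uniq//= Pl big1 ?addr0.
    by apply: Fe => //; case/andP: lab.
  move=> k /eqP kl; case: ifP => // Pk; apply: contrapT => /eqP Fk.
  exact/kl/F1.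
rewrite big_nat big1 ?normr0 ?ltW// => l lab; case: ifP => // Pl.
by apply: contrapT => /eqP Fl; apply: nl; exists l.
Qed.

(** Row sums have a single term, and labels beyond a suitable bound have small
    weight. *)
Lemma sparse_small z : sparse z -> small z.
Proof.
move=> [z1 zQ] eps eps0; pose Q := Num.truncn eps^-1.
have [N NP] := zQ Q; exists N => i a b Na; apply: sum_single => // l.
  move=> l' /eqP li /eqP l'i; rewrite !mulf_eq0 !negb_or.
  move=> /andP[zl _] /andP[zl' _]; apply: z1; rewrite ?li//.
    by move: zl; case: (z l); rewrite ?eqxx.
  by move: zl'; case: (z l'); rewrite ?eqxx.
move=> al _; case zl: (z l); last by rewrite mul0r normr0 ltW.
rewrite mul1r /label_wt ger0_norm ?invr_ge0//.
have Ql : (Q <= label_q l)%N.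
  rewrite leqNgt; apply/negP => /(NP l zl).
  by rewrite ltnNge (leq_trans Na al).
rewrite -[leRHS]invrK lef_pV2 ?posrE ?invr_gt0//.
by rewrite (le_trans (ltW (Num.Theory.truncnS_gt _)))// ler_nat.
Qed.

Lemma label_q_large N : exists Q, forall l, (Q <= label_q l)%N -> (N <= l)%N.
Proof.
exists (\max_(l < N) (label_q l).+1) => l Ql; rewrite leqNgt; apply/negP => lN.
have := leq_trans (leq_bigmax (F := fun l : 'I_N => (label_q l).+1) (Ordinal lN)) Ql.
by rewrite ltnn.
Qed.

(** Pick labels violating [P] with strictly increasing [q]. *)
Lemma sparse_of_bad (P : nat -> Prop) :
    (forall Q, exists2 l, (Q <= label_q l)%N & ~ P l) ->
  exists2 z, sparse z & forall N, exists2 l, (N <= l)%N & z l /\ ~ P l.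
Proof.
move=> bad; have /choice[g gP] : forall Q, exists l, (Q <= label_q l)%N /\ ~ P l.
  by move=> Q; have [l ? ?] := bad Q; exists l.
pose ls := fix ls t := g (if t is t'.+1 then (label_q (ls t')).+1 else 0%N).
have ls_lt t : (label_q (ls t) < label_q (ls t.+1))%N by exact: (gP _).1.
have lsP t : ~ P (ls t) by case: t => [|t]; exact: (gP _).2.
exists (fun l => `[< exists t, l = ls t >]).
  split=> [l l' /asboolP[t ->] /asboolP[t' ->]|Q].
    by rewrite /label_q => /(congr1 (pair_row p))/(@enum_inj _ ls_lt) ->.
  exists (\max_(t < Q) (ls t).+1)%N => _ /asboolP[t ->] tQ.
  have tQ' := leq_ltn_trans (enum_ge ls_lt t) tQ.
  exact: (leq_bigmax (F := fun t : 'I_Q => (ls t).+1) (Ordinal tQ')).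
move=> N; have [Q QN] := label_q_large N; exists (ls Q).
  exact/QN/(enum_ge ls_lt).
by split=> //; apply/asboolP; exists Q.
Qed.

Lemma unbounded_sum (F : nat -> R) eta : (forall l, 0 <= F l) -> 0 < eta ->
    (forall N, exists2 l, (N <= l)%N & eta <= F l) ->
  forall L, exists L', 1 <= \sum_(L <= l < L') F l.
Proof.
move=> F0 eta0 Finf L.
have sum_ge n : exists2 L', (L <= L')%N & n%:R * eta <= \sum_(L <= l < L') F l.
  elim: n => [|n [L' LL' IH]]; first by exists L; rewrite // mul0r big_geq.
  have [l L'l Fl] := Finf L'; exists l.+1; first exact: leq_trans LL' (leqW L'l).
  rewrite big_nat_recr ?(leq_trans LL')//= -natr1 mulrDl mul1r lerD//.
  apply: le_trans IH _; rewrite (@big_cat_nat _ _ _ L' L l)//= lerDl.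
  by rewrite sumr_ge0.
have [L' _ L'P] := sum_ge (Num.truncn eta^-1).+1; exists L'.
apply: le_trans L'P; rewrite -ler_pdivrMr// div1r.
exact/ltW/Num.Theory.truncnS_gt.
Qed.

(** For a fixed [Q] with infinitely many bad rows, one bad label from each row
    already makes the series of [u] unbounded. So finitely many of them raise
    the sum by [1], and this is done on consecutive intervals with [Q]
    tending to infinity. *)
Lemma sparse_of_bad_rows (u : nat -> R) (eta : nat -> R) : (forall Q, 0 < eta Q) ->
    (forall Q0, exists2 Q, (Q0 <= Q)%N & forall i0, exists2 i, (i0 <= i)%N &
      exists2 c, (c <= Q)%N & eta Q < u (label Q i c)) ->
  exists2 z, sparse z & ~ cauchy_series (fun l => (z l)%:R * u l).
Proof.
move=> eta0 bad.
(* The least bad label of its row. *)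
pose zQ Q l := [&& label_q l == Q, (label_c l <= Q)%N, eta Q < u l &
  [forall c : 'I_(label_c l), u (label Q (label_i l) c) <= eta Q]].
have zQ_inj Q l l' : zQ Q l -> zQ Q l' -> pair_row p l = pair_row p l' -> l = l'.
  move=> /and4P[/eqP lQ _ ul /forallP ml] /and4P[/eqP l'Q _ ul' /forallP ml'] ll'.
  have ii' : label_i l = label_i l' by rewrite /label_i ll'.
  have [cc'|cc'|cc'] := ltngtP (label_c l) (label_c l').
  - have := ml' (Ordinal cc'); rewrite /= -ii' -lQ label_decode lQ => ul2.
    by have := lt_le_trans ul ul2; rewrite ltxx.
  - have := ml (Ordinal cc'); rewrite /= ii' -l'Q label_decode l'Q => ul2.
    by have := lt_le_trans ul' ul2; rewrite ltxx.
  by rewrite -(label_decode l) -(label_decode l') lQ l'Q ii' cc'.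
have step (s : nat * nat) : exists t : nat * nat,
    [/\ (s.1 <= t.1)%N, (s.2 < t.2)%N
      & 1 <= \sum_(s.2 <= l < t.2) (zQ t.1 l)%:R * u l].
  have [Q Q0Q Qbad] := bad s.1.
  have [l|N|L' sumL'] := @unbounded_sum (fun l => (zQ Q l)%:R * u l) (eta Q) _ (eta0 Q) _ s.2.
  - case zl: (zQ Q l); last by rewrite mul0r.
    by rewrite mul1r ltW// (lt_trans (eta0 Q))//; case/and4P: zl.
  - have [i Ni [c0 c0Q uc0]] := Qbad (\max_(l < N) (label_i l).+1)%N.
    have cex : exists c, (c <= Q)%N && (eta Q < u (label Q i c)).
      by exists c0; rewrite c0Q.
    have [c /andP[cQ uc] cmin] := ex_minnP cex.
    have [rl ql il cl] := labelK Q i c; exists (label Q i c).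
      rewrite leqNgt; apply/negP => lN.
      have := leq_trans (leq_bigmax (F := fun l : 'I_N => (label_i l).+1) (Ordinal lN)) Ni.
      by rewrite /= il ltnn.
    rewrite (_ : zQ _ _) ?mul1r ?ltW//; apply/and4P; rewrite ql cl il; split=> //.
    apply/forallP => -[c' /= c'c]; rewrite leNgt; apply/negP => uc'.
    have := cmin c'; rewrite uc' (leq_trans (ltnW c'c) cQ) => /(_ isT).
    by rewrite leqNgt c'c.
  exists (Q, L'); split=> //=; rewrite ltnNge; apply/negP => L'L.
  by move: sumL'; rewrite big_geq// ler10.
have /choice[next nextP] := step.
pose st := fix st t := next (if t is t'.+1 then (t, (st t').2) else (0, 0)%N).
pose Qt t := (st t).1; pose L t := if t is t'.+1 then (st t').2 else 0%N.
have stP t : [/\ (t <= Qt t)%N, (L t < L t.+1)%N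
    & 1 <= \sum_(L t <= l < L t.+1) (zQ (Qt t) l)%:R * u l].
  case: t => [|t]; first exact: (nextP (0, 0)%N).
  exact: (nextP (t.+1, (st t).2)).
have L_lt t : (L t < L t.+1)%N by have [] := stP t.
pose inb t l := (L t <= l < L t.+1)%N.
have inb_uniq t t' l : inb t l -> inb t' l -> t = t'.
  move=> /andP[t1 t2] /andP[t1' t2'].
  have := leq_ltn_trans t1 t2'; have := leq_ltn_trans t1' t2.
  by rewrite !(enum_ltn L_lt) !ltnS => h1 h2; apply/eqP; rewrite eqn_leq h1 h2.
pose z : bits := fun l => `[< exists2 t, inb t l & zQ (Qt t) l >].
have zE t l : inb t l -> z l = zQ (Qt t) l.
  move=> tl; apply/asboolP/idP => [[t' t'l]|]; last by exists t.
  by rewrite (inb_uniq _ _ _ tl t'l).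
exists z; first split.
- move=> l l' /asboolP[t tl zl] /asboolP[t' t'l' zl'] ll'.
  have QQ : Qt t = Qt t'.
    case/and4P: (zl) => /eqP <- _ _ _; case/and4P: (zl') => /eqP <- _ _ _.
    by rewrite /label_q ll'.
  by apply: (zQ_inj _ _ _ zl); rewrite ?QQ.
- move=> Q; exists (L Q) => l /asboolP[t /andP[_ tl] /and4P[/eqP lQ _ _ _]] Ql.
  have tQ : (t.+1 <= Q)%N by have [h _ _] := stP t; rewrite (leq_ltn_trans h)// -lQ.
  by rewrite (leq_trans tl)// leqNgt (enum_ltn L_lt) -leqNgt.
move=> /(_ 2^-1 ltac:(lra))[N NP]; have [_ _ h] := stP N.
have := NP (L N) (L N.+1) (enum_ge L_lt N).
have -> : \sum_(L N <= l < L N.+1) (z l)%:R * u l =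
    \sum_(L N <= l < L N.+1) (zQ (Qt N) l)%:R * u l.
  by rewrite !big_nat; apply: eq_bigr => l lN; rewrite (zE N).
by rewrite ler_norml; lra.
Qed.

End NotLeFinite.

(** Sparse selections are small, so for them the oscillations tend to [0] and the
    endpoint series converges. As all sub-selections are sparse too, the
    endpoint increments in each of the finitely many target rows are
    absolutely small, in the sense that for large [Q] all but finitely many rows
    [p (Q, i)] have increments below [eta Q]. One complete row for each large [Q]
    then gives an absolutely convergent image, although these rows have sum
    [1]. *)
Section Conclusion.
Variables (R : realType) (p : pairing) (m : nat).
Hypothesis m_gt0 : (0 < m)%N.

Let partial (j : 'I_m) (k : nat) (b : {ptws nat -> R}) : R :=
  \sum_(0 <= t < k) b (m * t + j)%N.

Let partial_cont j k : continuous (partial j k).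
Proof.
elim: k => [|k IH].
  have -> : partial j 0 = fun=> 0.
    by apply/funext => b; rewrite /partial big_geq.
  exact: (@cst_continuous {ptws nat -> R} R 0).
have -> : partial j k.+1 = fun b => partial j k b + b (m * k + j)%N.
  by apply/funext => b; rewrite /partial big_nat_recr.
move=> b; apply: (@cvgD _ _ _ (nbhs b) _ (partial j k) (fun b => b (m * k + j)%N)).
  exact: IH.
exact: (@ptws_coord_continuous R (m * k + j)).
Qed.

Let finP (b b' : {ptws nat -> R}) : quot_rel (cs_fin R m) b b' <->
  forall j, cauchy_seq (fun k => partial j k b - partial j k b').
Proof.
rewrite /quot_rel cs_finP// row_cauchy_partial; last by move=> i j; lia.
suff E (j : 'I_m) : (fun k => \sum_(0 <= t < k) (b (m * t + j)%N - b' (m * t + j)%N)) =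
    (fun k => partial j k b - partial j k b') by split=> h j; have := h j; rewrite E.
by apply/funext => k; rewrite sumrB.
Qed.

(** The [Q + 1] labels of a complete row contribute at most [2^-1 ^+ Q]. *)
Let eta (Q : nat) : R := 2^-1 ^+ Q / Q.+1%:R.

Let eta_gt0 Q : 0 < eta Q.
Proof. by rewrite divr_gt0// exprn_gt0// invr_gt0. Qed.

Lemma cs_inf_not_le_cs_fin :
  ~ borel_le (quot_rel (cs_inf R p)) (quot_rel (cs_fin R m)).
Proof.
case=> theta bt tP.
have e_lt i j : (p (i, j) < p (i, j.+1))%N by exact: pair_code_lt.
have rowE i j : predT i -> pair_row p (p (i, j)) = i.
  by rewrite /pair_row pair_codeK.
have colE i j : predT i -> label_c p (p (i, j)) = j.
  by rewrite /label_c pair_codeK.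
have [K [h [s [K_lt sh sP _]]]] := normal_form (rowof := pair_row p)
  (colof := label_c p) (row := pair_row p) (@cs_infP R p)
  e_lt rowE colE finP partial_cont (@label_wt R p) (fun=> isT)
  (@pair_row_inf p) bt tP.
pose u j l := h j l (K l.+1).
have sparseP z : sparse p z -> forall j,
    (forall e, 0 < e -> exists N, forall l k, (N <= l)%N ->
      (K l <= k <= K l.+1)%N -> `|(z l)%:R * h j l k| <= e) /\
    cauchy_series (fun l => (z l)%:R * u j l).
  move=> /(sparse_small (R := R))/sP sz j.
  exact: (cauchy_increments K_lt (sh z j) (sz j)).
have osc_small j e : 0 < e -> exists Q, forall l, (Q <= label_q p l)%N ->
    forall k, (K l <= k <= K l.+1)%N -> `|h j l k| <= e.
  move=> e0; apply: contrapT => nQ.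
  have [Q|z sz zbad] := @sparse_of_bad p (fun l => forall k,
      (K l <= k <= K l.+1)%N -> `|h j l k| <= e).
    apply: contrapT => nl; apply: nQ; exists Q => l Ql; apply: contrapT => bl.
    by apply: nl; exists l.
  have [/(_ _ e0)[N NP] _] := sparseP z sz j.
  have [l Nl [zl]] := zbad N; apply => k lk.
  by have := NP l k Nl lk; rewrite zl mul1r.
have u_small (js : 'I_m * bool) : \forall Q \near \oo, exists i0,
    forall i, (i0 <= i)%N -> forall c, (c <= Q)%N ->
    (-1) ^+ js.2 * u js.1 (label p Q i c) <= eta Q.
  case: js => j sg /=; apply: contrapT => nQ.
  have [Q0|z sz] := @sparse_of_bad_rows R p (fun l => (-1) ^+ sg * u j l) eta eta_gt0.
    apply: contrapT => nb; apply: nQ; exists Q0 => // Q /= Q0Q.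
    apply: contrapT => nQ; apply: nb; exists Q => // i0.
    apply: contrapT => ni; apply: nQ; exists i0 => i i0i c cQ.
    rewrite leNgt; apply/negP => uc; apply: ni; exists i => //; by exists c.
  apply => e e0; have [_ /(_ _ e0)[N NP]] := sparseP z sz j.
  exists N => a b Na; under eq_bigr do rewrite mulrCA.
  by rewrite -mulr_sumr normrM normrX normrN1 expr1n mul1r NP.
have [Q0 _ Q0P] := filter_forall _ u_small.
have /choice[iQ iQP] : forall Q, exists i, (Q0 <= Q)%N -> forall j c, (c <= Q)%N ->
    `|u j (label p Q i c)| <= eta Q.
  move=> Q; have [Q0Q|] := leqP Q0 Q; last by exists 0%N.
  have /choice[i0 i0P] := Q0P Q Q0Q.
  exists (\max_js i0 js) => _ j c cQ.
  have le_i0 js : (i0 js <= \max_js i0 js)%N by exact: leq_bigmax.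
  have := i0P (j, false) _ (le_i0 _) c cQ; have := i0P (j, true) _ (le_i0 _) c cQ.
  by rewrite /= expr0 expr1 mul1r mulN1r ler_norml; lra.
(* One complete row, that of code [p (Q, iQ Q)], for each [Q >= Q0]. *)
pose z : bits := fun l => [&& (Q0 <= label_q p l)%N,
  label_i p l == iQ (label_q p l) & (label_c p l <= label_q p l)%N].
have z_fin Q : exists N, forall l, z l -> (label_q p l < Q)%N -> (l < N)%N.
  exists (\max_(Q' < Q) \max_(c < Q) (label p Q' (iQ Q') c).+1)%N => l.
  move=> /and3P[_ /eqP il cl] lQ.
  have h1 := leq_bigmax (F := fun c : 'I_Q =>
    (label p (label_q p l) (iQ (label_q p l)) c).+1) (Ordinal (leq_ltn_trans cl lQ)).
  have h2 := leq_bigmax (F := fun Q' : 'I_Q =>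
    \max_(c < Q) (label p Q' (iQ Q') c).+1)%N (Ordinal lQ).
  by have := leq_trans h1 h2; rewrite /= -il label_decode.
have : small (pair_row p) (@label_wt R p) z.
  apply/sP => j; apply: (increments_cauchy K_lt (sh z j)) => e e0.
    have [Q QP] := osc_small j e e0; have [N NP] := z_fin Q.
    exists N => l k Nl lk; case zl: (z l); last by rewrite mul0r normr0 ltW.
    rewrite mul1r; apply: QP => //; rewrite leqNgt; apply/negP => /(NP l zl).
    by rewrite ltnNge Nl.
  have [Q2 Q2P] := @half_pow_small R (e / 2) ltac:(lra).
  have [N NP] := z_fin Q2; exists N => a b Na.
  pose B := \max_(l < b) (label_q p l).+1.
  (* [S] lists, row by row, a superset of the selected labels in [[a, b[]. *)
  pose S := [seq label p Q (iQ Q) c | Q <- index_iota (maxn Q0 Q2) B, c <- iota 0 Q.+1].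
  apply: le_trans (ler_norm_sum _ _ _) _.
  have -> : \sum_(a <= l < b) `|(z l)%:R * u j l| =
      \sum_(l <- [seq l <- index_iota a b | z l]) `|u j l|.
    rewrite big_filter [RHS]big_mkcond; apply: eq_bigr => l _.
    by case: (z l); rewrite ?mul1r// mul0r normr0.
  apply: (@le_trans _ _ (\sum_(l <- S) `|u j l|)).
    apply: ler_sum_uniq => //; first by rewrite filter_uniq ?iota_uniq.
    move=> l; rewrite mem_filter mem_index_iota => /andP[zl /andP[al lb]].
    have /and3P[Q0l /eqP il cl] := zl.
    apply/allpairsPdep; exists (label_q p l), (label_c p l); split.
    - rewrite mem_index_iota geq_max Q0l /=; apply/andP; split.
        rewrite leqNgt; apply/negP => /(NP l zl).
        by rewrite ltnNge (leq_trans Na al).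
      exact: (leq_bigmax (F := fun l : 'I_b => (label_q p l).+1) (Ordinal lb)).
    - by rewrite mem_iota /= add0n ltnS.
    - by rewrite -il label_decode.
  rewrite big_allpairs_dep.
  apply: (@le_trans _ _ (\sum_(maxn Q0 Q2 <= Q < B) 2^-1 ^+ Q)).
    rewrite !big_nat; apply: ler_sum => Q /andP[]; rewrite geq_max => /andP[Q0Q _] _.
    apply: (@le_trans _ _ (\sum_(c <- iota 0 Q.+1) eta Q)).
      rewrite !big_seq; apply: ler_sum => c; rewrite mem_iota /= add0n ltnS => cQ.
      exact: iQP.
    rewrite big_const_seq count_predT size_iota iter_addr_0 -[leLHS]mulr_natr /eta.
    by rewrite divfK// pnatr_eq0.
  apply: le_trans (sum_half_pow _ _ _) _.
  by have := Q2P _ (leq_maxr Q0 Q2); lra.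
move=> /(_ 2^-1 ltac:(lra))[N NP].
have [Q1 Q1P] := label_q_large p N; pose Q := maxn Q0 Q1.
pose r := p (Q, iQ Q).
have rE c : [/\ pair_row p (p (r, c)) = r, label_q p (p (r, c)) = Q,
  label_i p (p (r, c)) = iQ Q & label_c p (p (r, c)) = c] by exact: labelK.
have r_lt c : (p (r, c) < p (r, c.+1))%N by exact: e_lt.
have rP l : pair_row p l == r <-> exists c, l = p (r, c).
  split=> [/eqP <-|[c ->]]; last by case: (rE c) => ->.
  by exists (label_c p l); rewrite /pair_row /label_c -surjective_pairing pair_decodeK.
have := NP r N (p (r, Q.+1)) (leqnn N); rewrite (sum_enum r_lt rP).
have -> : enum_count r_lt N = 0%N.
  apply/eqP; rewrite -leqn0 enum_count_leq; apply: Q1P.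
  by case: (rE 0%N) => _ -> _ _; rewrite leq_maxr.
rewrite (enum_count_enum r_lt) big_nat (eq_bigr (fun=> Q.+1%:R^-1)); last first.
  move=> c /= cQ; have [_ qE iE cE] := rE c.
  by rewrite /z /label_wt qE iE cE eqxx leq_maxl -ltnS cQ mul1r.
rewrite -big_nat sumr_const_nat subn0 -[_ *+ _]mulr_natr mulVf ?pnatr_eq0//.
by rewrite normr1; lra.
Qed.

End Conclusion.

Lemma null_lt_cs_fin (R : realType) (p : pairing) m : (0 < m)%N ->
  borel_lt (quot_rel (null_seq R)) (quot_rel (cs_fin R m)).
Proof.
move=> m0; split; last exact: cs_fin_not_le_null.
apply: null_le_coef => n; apply/eqP => x0.
have : x_fin R m n (n %% m)%N = 0 by rewrite x0.
rewrite /x_fin c0_sumE (@sum_indicator _ (fun k => m * k + n %% m)%N); last first.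
  by move=> k; lia.
rewrite leq_addl /= (_ : `[< _ >] = true) => [/eqP|]; first by rewrite oner_eq0.
by apply/asboolP; exists 0%N; rewrite muln0.
Qed.

Theorem theorem1p4 (R : realType) (p : pairing) :
  (forall m : nat, (1 <= m)%N ->
    [/\ borel_lt (quot_rel (null_seq R)) (quot_rel (cs_fin R m)),
        borel_le (quot_rel (cs_fin R m)) (quot_rel (cs_fin R m.+1)) &
        borel_lt (quot_rel (cs_fin R m.+1)) (quot_rel (cs_inf R p))])
  /\
  (forall x : nat -> c0 R, (forall n, x n != 0) ->
    borel_le (quot_rel (null_seq R)) (E_rel x) /\
    borel_le (E_rel x) (quot_rel (cs_inf R p))).
Proof.
split=> [m m1|x x0]; split.
- exact: null_lt_cs_fin.
- exact: cs_fin_le_succ.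
- by split; [exact: coef_le_cs_inf|exact: cs_inf_not_le_cs_fin].
- exact: null_le_coef.
- exact: coef_le_cs_inf.
Qed.
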